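(* MEFE-Matching can be solved in polynomial time on instances in which the degree of each TA is one. That is, there is a polynomial-time algorithm that, given such an instance, outputs a MEFE matching if one exists and correctly reports that none exists otherwise.
   Context: An instance of MEFE-Matching consists of: a finite set of courses $X=\{x_1,\dots,x_n\}$; a finite set of TAs $T=\{t_1,\dots,t_m\}$; for each TA $t_i$ a utility (valuation) function $u_i=u_{t_i}\colon X\to\mathbb{Z}_{\ge 0}$ and a grade function $g_i=g_{t_i}\colon X\to\mathbb{Q}_{\ge 0}$; for each course $x_i$ a capacity $c_i$ (a positive integer) and a utility (valuation) function $v_i=v_{x_i}\colon T\to\mathbb{Z}_{\ge 0}$, where for every TA $t$ and course $x_i$ one has $v_i(t)=0$ if $u_t(x_i)=0$ and $v_i(t)>0$ otherwise; and a number $k\in\mathbb{Q}_{\ge 0}$. All numbers are encoded in binary. The degree of a TA is the number of courses it values positively. A matching is a function $\mu\colon T\to X\cup\{\emptyset\}$, where $\mu(t)=\emptyset$ means $t$ is unassigned; by convention $u_t(\emptyset)=0$. It is feasible if $|\mu^{-1}(x_i)|=c_i$ for every course $x_i$ and no TA $t$ is assigned to a course $x$ with $u_t(x)=0$. A MEFE (merit-based envy-free egalitarian) matching is a feasible matching $\mu$ such that (1) (satisfaction of courses) for every course $x_i$, $\mathrm{AvgUtil}(x_i)=\frac{1}{c_i}\sum_{t\in\mu^{-1}(x_i)}v_i(t)\ge k$; and (2) (merit-based envy-freeness) there are no two TAs $t_i,t_j$ with $\mu(t_j)\in X$, $g_i(\mu(t_j))\ge g_j(\mu(t_j))$ and $u_i(\mu(t_j))>u_i(\mu(t_i))$.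 *)

(* Defs.v *)
From HB Require Import structures.
From mathcomp Require Import all_boot all_order all_algebra.

Set Implicit Arguments.
Unset Strict Implicit.
Unset Printing Implicit Defensive.

Import Order.TTheory GRing.Theory Num.Theory.

Local Open Scope ring_scope.

Inductive symbol := Blank | Bit of bool | Sep.

Definition is_blank (s : symbol) : bool := if s is Blank then true else false.

Inductive move := MoveLeft | MoveRight | Stay.

(* A tape is infinite in both directions: [left_of] lists the cells to the left
   of the head, nearest first; the head scans the first element of [right_of];
   all cells not listed contain [Blank]. *)
Record tape := Tape { left_of : seq symbol; right_of : seq symbol }.

Definition scan (t : tape) : symbol := head Blank (right_of t).

Definition write (s : symbol) (t : tape) : tape :=
  Tape (left_of t) (s :: behead (right_of t)).

Definition move_head (d : move) (t : tape) : tape :=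
  match d with
  | MoveLeft => Tape (behead (left_of t)) (head Blank (left_of t) :: right_of t)
  | MoveRight => Tape (scan t :: left_of t) (behead (right_of t))
  | Stay => t
  end.

(* There are [extra_tapes.+1] tapes; [trans q r = None] means that the machine
   halts in state [q] when it scans the symbols [r]. *)
Record tm := TM {
  extra_tapes : nat;
  state : finType;
  start : state;
  trans : state -> {ffun 'I_extra_tapes.+1 -> symbol} ->
          option (state * {ffun 'I_extra_tapes.+1 -> symbol * move})
}.

Definition config (M : tm) : Type :=
  (state M * {ffun 'I_(extra_tapes M).+1 -> tape})%type.

Definition step (M : tm) (c : config M) : option (config M) :=
  if trans c.1 [ffun i => scan (c.2 i)] is Some (q, a)
  then Some (q, [ffun i => move_head (a i).2 (write (a i).1 (c.2 i))])
  else None.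

Definition init (M : tm) (w : seq symbol) : config M :=
  (start M, [ffun i => Tape [::] (if i == ord0 then w else [::])]).

(* The output is read on tape 0, from the head rightwards to the first blank. *)
Definition output (M : tm) (c : config M) : seq symbol :=
  let r := right_of (c.2 ord0) in take (find is_blank r) r.

Definition computes_within (M : tm) (T : nat) (w out : seq symbol) : Prop :=
  exists (t : nat) (c : config M),
    [/\ (t <= T)%N, iter t (obind (@step M)) (Some (init M w)) = Some c,
        step c = None & output c = out].

(* [R x y] says that [y] is a solution of the instance [x]; only the instances
   satisfying the promise [P] are considered.  The answer [None] is the report
   that there is no solution. *)
Definition solvable_in_polynomial_time_on
    (I : Type) (S : I -> Type)
    (encode_input : I -> seq symbol)
    (encode_output : forall x : I, option (S x) -> seq symbol)
    (P : I -> Prop) (R : forall x : I, S x -> Prop) : Prop :=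
  exists (M : tm) (p : {poly nat}), forall x : I, P x ->
    exists ans : option (S x),
      computes_within M p.[size (encode_input x)]
        (encode_input x) (encode_output x ans)
      /\ match ans with
         | Some y => R x y
         | None => ~ exists y : S x, R x y
         end.

Record instance := Instance {
  ncourses : nat;
  ntas : nat;
  ta_util : 'I_ntas -> 'I_ncourses -> nat;
  grade : 'I_ntas -> 'I_ncourses -> rat;
  capacity : 'I_ncourses -> nat;
  course_util : 'I_ncourses -> 'I_ntas -> nat;
  threshold : rat;
  grade_ge0 : forall t x, 0 <= grade t x;
  capacity_gt0 : forall x, (0 < capacity x)%N;
  course_util_eq0 : forall t x, ta_util t x = 0%N -> course_util x t = 0%N;
  course_util_gt0 :
    forall t x, ta_util t x <> 0%N -> (0 < course_util x t)%N;
  threshold_ge0 : 0 <= threshold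
}.

Definition degree (I : instance) (t : 'I_(ntas I)) : nat :=
  #|[set x : 'I_(ncourses I) | (0 < ta_util t x)%N]|.

Definition matching (I : instance) : Type :=
  {ffun 'I_(ntas I) -> option 'I_(ncourses I)}.

Definition assigned (I : instance) (mu : matching I) (x : 'I_(ncourses I)) :
    {set 'I_(ntas I)} :=
  [set t | mu t == Some x].

Definition util (I : instance) (t : 'I_(ntas I))
    (o : option 'I_(ncourses I)) : nat :=
  if o is Some x then ta_util t x else 0%N.

Definition feasible (I : instance) (mu : matching I) : Prop :=
  (forall x, #|assigned mu x| = capacity x) /\
  ~ (exists t x, mu t = Some x /\ ta_util t x = 0%N).

Definition avg_util (I : instance) (mu : matching I) (x : 'I_(ncourses I)) :
    rat :=
  (capacity x)%:R^-1 * \sum_(t in assigned mu x) (course_util x t)%:R.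

Definition merit_envy (I : instance) (mu : matching I)
    (ti tj : 'I_(ntas I)) : Prop :=
  exists y : 'I_(ncourses I),
    [/\ mu tj = Some y, grade ti y >= grade tj y
      & (util ti (Some y) > util ti (mu ti))%N].

Definition mefe (I : instance) (mu : matching I) : Prop :=
  [/\ feasible mu,
      forall x, avg_util mu x >= threshold I
    & ~ exists ti tj, merit_envy mu ti tj].

(* Binary digits of [n], least significant first, without leading zeros. *)
Definition bits (n : nat) : seq bool :=
  mkseq (fun i => odd (n %/ 2 ^ i)) (up_log 2 n.+1).

Definition encode_nat (n : nat) : seq symbol := rcons (map Bit (bits n)) Sep.

(* Only used for nonnegative rationals, in lowest terms. *)
Definition encode_rat (q : rat) : seq symbol :=
  encode_nat `|numq q|%N ++ encode_nat `|denq q|%N.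

(* The numbers of courses and TAs and the threshold, followed by one block per
   course: its capacity, and then its data with respect to each TA. *)
Definition encode_instance (I : instance) : seq symbol :=
  encode_nat (ncourses I) ++ encode_nat (ntas I) ++ encode_rat (threshold I) ++
  flatten [seq encode_nat (capacity x) ++
               flatten [seq encode_nat (ta_util t x) ++
                            encode_rat (grade t x) ++
                            encode_nat (course_util x t)
                       | t <- enum 'I_(ntas I)]
          | x <- enum 'I_(ncourses I)].

(* A matching is given by the list of the courses of the TAs; 0 stands for
   "unassigned" and [i.+1] for the course of index [i]. *)
Definition encode_answer (I : instance) (ans : option (matching I)) :
    seq symbol :=
  if ans is Some mu then
    Bit true ::
    flatten [seq encode_nat (if mu t is Some x then x.+1 else 0%N)
            | t <- enum 'I_(ntas I)]
  else [:: Bit false].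

(* Main.v *)
(** A TA of degree one who is unassigned envies every TA with at most the same
    merit holding a seat in the only course that she values.  Hence in a MEFE
    matching the TAs of a course [x] are exactly those TAs [t] valuing [x] for
    which at most [capacity x] TAs valuing [x] have a grade at least that of [t];
    so there is at most one MEFE matching, and it remains to check that each
    course gets [capacity x] TAs and satisfies the threshold.

    All this is expressible by arithmetic expressions built from 0, 1, +, *, the
    comparison [<=] and sums ranging over the numbers listed in the input.  Such an
    expression has values of polynomially many bits and is evaluated in polynomial
    time by a multitape machine keeping one number per tape. *)
Require Import Defs.
From mathcomp Require Import all_boot all_order all_algebra.
From mathcomp Require Import zify.

Set Implicit Arguments.
Unset Strict Implicit.
Unset Printing Implicit Defensive.

Import Order.TTheory GRing.Theory Num.Theory.

(** * Structured programs on tapes and their compilation *)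

(** The machine model is concrete, so a running time has to be exhibited. The only loop of the
    expression language runs through the fields of the input, whose number is at most the input
    length; hence bit widths and costs are polynomial by recursion on the syntax. The price is that
    everything must be said with such loops: the field of index [j] is the sum over all [k] of the
    [k]-th field times [[k = j]], and a sum over TAs or courses is a sum over field indices cut off
    at their number. The number of TAs is written in binary and might exceed the number of fields if
    there were no course; degree one excludes this, since a single TA forces a course and each
    course carries four fields per TA. Division is avoided by cross-multiplication, both for grades
    and for the average. *)

(* A tape without its trailing blanks on either side. *)
Definition zipper := (seq symbol * seq symbol)%type.

(** Dropping a blank laid on nothing keeps the lists in normal form, so that an erased tape is
    literally a pair of empty lists. *)
Definition lay (s : symbol) (l : seq symbol) : seq symbol :=
  if is_blank s && nilp l then [::] else s :: l.

Definition zscan (z : zipper) : symbol := head Blank z.2.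

Definition zmove (d : move) (z : zipper) : zipper :=
  match d with
  | MoveLeft => (behead z.1, lay (head Blank z.1) z.2)
  | MoveRight => (lay (head Blank z.2) z.1, behead z.2)
  | Stay => z
  end.

Definition action := (option symbol * move)%type.

Definition zact (a : action) (z : zipper) : zipper :=
  zmove a.2 (if a.1 is Some s then (z.1, lay s (behead z.2)) else z).

Definition store := nat -> zipper.

Definition upd (T : Type) (f : nat -> T) (i : nat) (z : T) : nat -> T :=
  fun j => if j == i then z else f j.

Definition acts := (action * action * action)%type.

Inductive prog :=
| Skip
| Act of nat & nat & nat & (symbol -> symbol -> symbol -> acts)
| Seq of prog & prog
| If of nat & (symbol -> bool) & prog & prog
| While of nat & (symbol -> bool) & prog.

Notation "p ;; q" := (Seq p q) (at level 61, right associativity).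

(** All three actions read the old store; if indices coincide, the last action wins. This is how
    actions on one or two tapes are obtained, and [select] tests its tapes in the same priority. *)
Definition act_store (i j k : nat) (r : acts) (f : store) : store :=
  upd (upd (upd f i (zact r.1.1 (f i))) j (zact r.1.2 (f j)))
      k (zact r.2 (f k)).

(* [exec p f n g]: [p] leads from [f] to [g] and [n] bounds the number of steps of
   the machine running it, the jumps of the compiled code included. *)
Inductive exec : prog -> store -> nat -> store -> Prop :=
| exec_skip f : exec Skip f 0 f
| exec_act i j k g (f : store) :
    exec (Act i j k g) f 1
      (act_store i j k (g (zscan (f i)) (zscan (f j)) (zscan (f k))) f)
| exec_seq p q f1 f2 f3 m n :
    exec p f1 m f2 -> exec q f2 n f3 -> exec (p ;; q) f1 (m + n) f3
| exec_if i (c : symbol -> bool) p q f g n :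
    exec (if c (zscan (f i)) then p else q) f n g ->
    exec (If i c p q) f n.+2 g
| exec_while_end i (c : symbol -> bool) p f :
    ~~ c (zscan (f i)) -> exec (While i c p) f 1 f
| exec_while_loop i (c : symbol -> bool) p f1 f2 f3 m n :
    c (zscan (f1 i)) -> exec p f1 m f2 -> exec (While i c p) f2 n f3 ->
    exec (While i c p) f1 (m + n).+2 f3
| exec_weaken p f g g' m n :
    exec p f m g -> m <= n -> g =1 g' -> exec p f n g'.

Record instr := Instr {
  tape1 : nat; tape2 : nat; tape3 : nat;
  effect : symbol -> symbol -> symbol -> acts * nat
}.

Definition idle : acts := ((None, Stay), (None, Stay), (None, Stay)).

Definition test (i : nat) (c : symbol -> bool) (a b : nat) : instr :=
  Instr i i i (fun x _ _ => (idle, if c x then a else b)).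

Fixpoint len (p : prog) : nat :=
  match p with
  | Skip => 0
  | Act _ _ _ _ => 1
  | Seq p q => len p + len q
  | If _ _ p q => (len p + (len q).+1).+1
  | While _ _ p => (len p).+2
  end.

(** [a] is the absolute address of the first instruction. A [test] on [xpredT] is an unconditional
    jump, its last argument being a dummy. *)
Fixpoint code (p : prog) (a : nat) : seq instr :=
  match p with
  | Skip => [::]
  | Act i j k g => [:: Instr i j k (fun x y z => (g x y z, a.+1))]
  | Seq p q => code p a ++ code q (a + len p)
  | If i c p q =>
      test i c a.+1 (a.+1 + len p).+1
      :: code p a.+1
      ++ test i xpredT ((a.+1 + len p).+1 + len q) 0
         :: code q (a.+1 + len p).+1
  | While i c p =>
      test i c a.+1 (a.+1 + len p).+1 :: code p a.+1 ++ [:: test i xpredT a 0]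
  end.

Lemma size_code p a : size (code p a) = len p.
Proof.
elim: p a => //= [p IHp q IHq|i c p IHp q IHq|i c p IHp] a.
- by rewrite size_cat IHp IHq.
- by rewrite size_cat /= IHp IHq.
- by rewrite size_cat /= IHp addn1.
Qed.

(** * The machine whose states are program counters, and its simulation of programs *)

Section Machine.

Variable C : seq instr.

Definition last_tape : nat :=
  \max_(x <- C) maxn (tape1 x) (maxn (tape2 x) (tape3 x)).

Definition select (x : instr) (a : acts) (i : nat) : action :=
  if i == tape3 x then a.2 else if i == tape2 x then a.1.2 else
  if i == tape1 x then a.1.1 else (None, Stay).

(** The address [size C], just past the code, is the halting state. A machine step always writes, so
    an action without a symbol writes back what is scanned. *)
Definition machine_trans (q : 'I_(size C).+1)
    (r : {ffun 'I_last_tape.+1 -> symbol}) :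
    option ('I_(size C).+1 * {ffun 'I_last_tape.+1 -> symbol * move}) :=
  if drop q C is x :: _ then
    let e := effect x (r (inord (tape1 x))) (r (inord (tape2 x)))
                      (r (inord (tape3 x))) in
    Some (inord e.2,
          [ffun i : 'I_last_tape.+1 => let a := select x e.1 i in
             (odflt (r i) a.1, a.2)])
  else None.

Definition machine : tm :=
  TM (ord0 : 'I_(size C).+1) machine_trans.

Definition pads (z : zipper) (t : tape) : Prop :=
  exists a b, left_of t = z.1 ++ nseq a Blank /\
              right_of t = z.2 ++ nseq b Blank.

Lemma pads_scan z t : pads z t -> scan t = zscan z.
Proof. by case=> a [b [_ /=]]; rewrite /scan /zscan => ->; case: z.2 => //;
  case: b. Qed.

Lemma lay_pad s l a :
  exists b, s :: l ++ nseq a Blank = lay s l ++ nseq b Blank.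
Proof.
rewrite /lay; case: s => [|b|] /=; try by exists a.
by case: l => /= [|x l]; [exists a.+1 | exists a].
Qed.

Lemma behead_pad l a :
  exists b, behead (l ++ nseq a Blank) = behead l ++ nseq b Blank.
Proof. by case: l => /= [|x l]; [exists a.-1; case: a | exists a]. Qed.

Lemma head_pad (l : seq symbol) a :
  head Blank (l ++ nseq a Blank) = head Blank l.
Proof. by case: l => //; case: a. Qed.

Lemma pads_move d z t : pads z t -> pads (zmove d z) (move_head d t).
Proof.
case: t => l r [a [b [/= -> ->]]]; case: d => /=; last by exists a, b.
- rewrite head_pad.
  have [b' ->] := lay_pad (head Blank z.1) z.2 b.
  by have [a' ->] := behead_pad z.1 a; exists a', b'.
- rewrite /scan /= head_pad.
  have [a' ->] := lay_pad (head Blank z.2) z.1 a.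
  by have [b' ->] := behead_pad z.2 b; exists a', b'.
Qed.

Lemma pads_write s z t :
  pads z t -> pads (z.1, lay s (behead z.2)) (write s t).
Proof.
case: t => l r [a [b [/= -> ->]]]; rewrite /write /=.
have [b1 ->] := behead_pad z.2 b; have [b2 ->] := lay_pad s (behead z.2) b1.
by exists a, b2.
Qed.

(** Writing back the scanned symbol can only turn an unlisted cell into a listed blank, which the
    padding absorbs. *)
Lemma pads_rewrite z t : pads z t -> pads z (write (scan t) t).
Proof.
case: t => l r [a [b [/= -> ->]]]; rewrite /write /scan /= head_pad.
by case: z => u [|x v] /=; [exists a, b.-1.+1; case: b | exists a, b].
Qed.

Lemma pads_act a z t :
  pads z t -> pads (zact a z) (move_head a.2 (write (odflt (scan t) a.1) t)).
Proof.
case: a => [[s|] d] zt; apply: pads_move; first exact: pads_write.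
exact: pads_rewrite.
Qed.

Definition at_pc (a : nat) (f : store) (c : config machine) : Prop :=
  nat_of_ord (c.1 : 'I_(size C).+1) = a /\
  forall i : 'I_last_tape.+1, pads (f i) (c.2 i).

Definition reach (n : nat) (c c' : config machine) : Prop :=
  exists2 m, m <= n & iter m (obind (@step machine)) (Some c) = Some c'.

Lemma reach_trans m n c1 c2 c3 :
  reach m c1 c2 -> reach n c2 c3 -> reach (m + n) c1 c3.
Proof.
move=> [i im E1] [j jn E2]; exists (j + i); first by lia.
by rewrite iterD E1.
Qed.

Lemma reach_weaken m n c1 c2 : m <= n -> reach m c1 c2 -> reach n c1 c2.
Proof. by move=> mn [i im E]; exists i => //; apply: leq_trans im mn. Qed.

Lemma at_pc_eq a f g c : f =1 g -> at_pc a f c -> at_pc a g c.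
Proof. by move=> fg [ca cf]; split=> // i; rewrite -fg. Qed.

Definition loaded (a : nat) (s : seq instr) : Prop :=
  exists pre post, C = pre ++ s ++ post /\ size pre = a.

Lemma loaded_cat a s1 s2 :
  loaded a (s1 ++ s2) -> loaded a s1 /\ loaded (a + size s1) s2.
Proof.
case=> pre [post [CE <-]]; split; first by exists pre, (s2 ++ post);
  rewrite CE -catA.
by exists (pre ++ s1), post; rewrite size_cat CE -!catA.
Qed.

Lemma loaded_cons a x s : loaded a (x :: s) -> loaded a [:: x] /\ loaded a.+1 s.
Proof. by rewrite -cat1s => /loaded_cat; rewrite /= addn1. Qed.

Lemma loaded_size a s : loaded a s -> a + size s <= size C.
Proof. by case=> pre [post [-> <-]]; rewrite !size_cat addnA leq_addr. Qed.

Lemma reach_step a x f c :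
  loaded a [:: x] -> at_pc a f c ->
  let r := effect x (zscan (f (tape1 x))) (zscan (f (tape2 x)))
                    (zscan (f (tape3 x))) in
  r.2 <= size C ->
  exists2 c', reach 1 c c' &
    at_pc r.2 (act_store (tape1 x) (tape2 x) (tape3 x) r.1 f) c'.
Proof.
case=> pre [post [CE preE]] [ca cf] r rC.
have le_tapes : maxn (tape1 x) (maxn (tape2 x) (tape3 x)) <= last_tape.
  rewrite /last_tape CE !big_cat big_seq1 /=.
  by apply: leq_trans (leq_maxr _ _); apply: leq_maxl.
have tapeE i : i <= maxn (tape1 x) (maxn (tape2 x) (tape3 x)) ->
    scan (c.2 (inord i)) = zscan (f i).
  move=> ix; rewrite (pads_scan (cf _)) inordK //.
  by rewrite ltnS (leq_trans ix).
have dropE : drop a C = x :: post by rewrite CE -preE drop_size_cat.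
have stepE : exists2 c', step c = Some c' &
    at_pc r.2 (fun i => zact (select x r.1 i) (f i)) c'.
  rewrite /step /= /machine_trans ca dropE /=.
  rewrite !ffunE !tapeE ?leq_max ?leqnn ?orbT // -/r.
  eexists; first by reflexivity.
  split=> /= [|i]; first by rewrite inordK.
  by rewrite !ffunE; apply: pads_act.
have [c' cc' c'r] := stepE; exists c'; first by exists 1.
apply: at_pc_eq c'r => i; rewrite /act_store /upd /select.
by do ![case: eqP => [->|_] //].
Qed.

Lemma reach_test a i b k l f c :
  loaded a [:: test i b k l] -> at_pc a f c ->
  (if b (zscan (f i)) then k else l) <= size C ->
  exists2 c', reach 1 c c' & at_pc (if b (zscan (f i)) then k else l) f c'.
Proof.
move=> ld cf le; have [//|c' cc' c'f] := reach_step ld cf.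
exists c' => //; apply: at_pc_eq c'f => t.
by rewrite /act_store /upd /=; do ![case: eqP => [->|_] //].
Qed.

(** The induction is on the derivation of [exec], not on the program: after one round of a loop the
    jump returns to address [a], where the hypothesis for the remaining rounds applies to the same
    loaded code. *)
Lemma simulation p f n g :
  exec p f n g -> forall a c, loaded a (code p a) -> at_pc a f c ->
  exists2 c', reach n c c' & at_pc (a + len p) g c'.
Proof.
elim=> {p f n g}.
- by move=> f a c _ cf; exists c; [exists 0 | rewrite addn0].
- move=> i j k r f a c ld cf.
  have [|c' cc' c'f] := reach_step ld cf.
    by have := loaded_size ld; rewrite addn1.
  by exists c' => //; rewrite addn1.
- move=> p q f1 f2 f3 m n _ IHp _ IHq a c /loaded_cat[ldp].
  rewrite size_code => ldq cf.
  have [c2 cc2 c2f] := IHp _ _ ldp cf.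
  have [c3 cc3 c3f] := IHq _ _ ldq c2f.
  by exists c3; [exact: reach_trans cc2 cc3 | rewrite addnA].
- move=> i b p q f g n _ IH a c /= /loaded_cons[ld1 /loaded_cat[ldp]].
  rewrite size_code => /loaded_cons[ld2 ldq] cf.
  have szq := loaded_size ldq; rewrite size_code in szq.
  have [|c1 cc1 c1f] := reach_test ld1 cf; first by case: ifP; lia.
  case: ifP IH c1f => _ IH c1f.
  + have [c2 cc2 c2f] := IH _ _ ldp c1f.
    have [|c3 cc3 c3f] := reach_test ld2 c2f; first by [].
    exists c3; first by
      apply: reach_weaken (reach_trans (reach_trans cc1 cc2) cc3); lia.
    by have -> : a + (len p + (len q).+1).+1 = (a.+1 + len p).+1 + len q by lia.
  + have [c2 cc2 c2f] := IH _ _ ldq c1f.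
    exists c2; first by apply: reach_weaken (reach_trans cc1 cc2); lia.
    by have -> : a + (len p + (len q).+1).+1 = (a.+1 + len p).+1 + len q by lia.
- move=> i b p f /negbTE nb a c /= /loaded_cons[ld1 /loaded_cat[ldp]].
  move=> /loaded_size; rewrite size_code /= => sz cf.
  have [|c1 cc1 c1f] := reach_test ld1 cf; first by rewrite nb; lia.
  by exists c1 => //; rewrite nb in c1f; rewrite !addnS.
- move=> i b p f1 f2 f3 m n b1 _ IHp _ IHw a c ld cf.
  have /= /loaded_cons[ld1 /loaded_cat[ldp ld2]] := ld.
  rewrite size_code in ld2.
  have := loaded_size ld2; rewrite /= => sz.
  have [|c1 cc1 c1f] := reach_test ld1 cf; first by rewrite b1; lia.
  rewrite b1 in c1f; have [c2 cc2 c2f] := IHp _ _ ldp c1f.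
  have [|c3 cc3 c3f] := reach_test ld2 c2f; first by rewrite /=; lia.
  have [c4 cc4 c4f] := IHw _ _ ld c3f; exists c4 => //.
  apply: reach_weaken (reach_trans (reach_trans (reach_trans cc1 cc2) cc3) cc4).
  lia.
- move=> p f g g' m n _ IH mn gg' a c ld cf.
  have [c' cc' c'f] := IH _ _ ld cf.
  by exists c'; [apply: reach_weaken cc' | apply: at_pc_eq c'f].
Qed.

End Machine.

Definition nonblank (s : symbol) : bool := ~~ is_blank s.

Definition input_store (w : seq symbol) : store :=
  fun i => ([::], if i == 0 then w else [::]).

Lemma exec_computes p w n f out :
  exec p (input_store w) n f -> all nonblank out -> f 0 = ([::], out) ->
  computes_within (machine (code p 0)) n w out.
Proof.
move=> pf nb f0.
have ld : loaded (code p 0) 0 (code p 0) by exists [::], [::]; rewrite cats0.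
have [|c [m mn it] [ca cf]] := simulation pf (c := init (machine (code p 0)) w) ld.
  split=> //= i; rewrite ffunE; exists 0, 0; rewrite /= !cats0; split=> //.
exists m, c; split=> //.
  rewrite /step /= /machine_trans ca add0n -[len p](size_code p 0).
  by rewrite drop_size.
have [a [b [_ E]]] := cf ord0; rewrite /output E f0 /=.
rewrite find_cat; have -> : has is_blank out = false.
  by apply/negbTE; rewrite -all_predC.
have -> : find is_blank (nseq b Blank) = 0 by case: b {E}.
by rewrite addn0 take_size_cat.
Qed.

(** * Binary numbers on tapes *)

Ltac lookup := rewrite /upd; repeat (case: eqP => ?; try lia); try assumption.

(** Stores are functions and are compared only by [=1]; comparing the tape indices case by case
    avoids extensionality. *)
Ltac pointwise :=
  let t := fresh "t" in
  move=> t; rewrite /act_store /upd /=;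
  repeat (case: eqP => ?; try lia); subst; try done; try congruence;
  try by repeat match goal with
    | H : ?f ?i = _ |- context [?f ?i] => rewrite H
    end.

Definition empty : zipper := ([::], [::]).

Definition is_true_bit (s : symbol) : bool := if s is Bit b then b else false.
Definition is_false_bit (s : symbol) : bool := if s is Bit b then ~~ b else false.
Definition is_bit (s : symbol) : bool := if s is Bit _ then true else false.

Definition act1 (i : nat) (a : action) : prog :=
  Act i i i (fun _ _ _ => (a, a, a)).

Definition act2 (i j : nat) (g : symbol -> action * action) : prog :=
  Act i j j (fun x _ _ => ((g x).1, (g x).2, (g x).2)).

Lemma exec_act1 i a f : exec (act1 i a) f 1 (upd f i (zact a (f i))).
Proof. by apply: exec_weaken (exec_act _ _ _ _ _) _ _ => //; pointwise. Qed.

Lemma exec_act2 i j g f : i != j ->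
  exec (act2 i j g) f 1 (upd (upd f i (zact (g (zscan (f i))).1 (f i)))
                             j (zact (g (zscan (f i))).2 (f j))).
Proof. by move=> ij; apply: exec_weaken (exec_act _ _ _ _ _) _ _ => //;
  pointwise. Qed.

(** With nothing to the left of the head, the erased cell is dropped by [lay], so a tape consumed by
    [pop] keeps an empty left part. *)
Definition pop : action := (Some Blank, MoveRight).
Definition shift (d : move) : action := (None, d).
Definition put (s : symbol) : action := (Some s, MoveRight).

Lemma zact_pop x v : zact pop ([::], x :: v) = ([::], v).
Proof. by case: v. Qed.

Lemma zact_left u v :
  zact (shift MoveLeft) (u, v) = (behead u, lay (head Blank u) v).
Proof. by []. Qed.

Lemma zact_right u x v :
  nonblank x -> zact (shift MoveRight) (u, x :: v) = (x :: u, v).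
Proof. by case: x. Qed.

Lemma zact_put s u v :
  nonblank s -> zact (put s) (u, v) = (s :: u, behead v).
Proof. by case: s. Qed.

Definition rewind (i : nat) : prog :=
  act1 i (shift MoveLeft) ;; While i nonblank (act1 i (shift MoveLeft)) ;;
  act1 i (shift MoveRight).

Lemma exec_rewind_loop i u v f :
  all nonblank u -> f i = (behead u, lay (head Blank u) v) ->
  exec (While i nonblank (act1 i (shift MoveLeft))) f (3 * size u + 1)
       (upd f i ([::], lay Blank (rev u ++ v))).
Proof.
elim: u v f => [|x u IH] v f /= => [_ fi|/andP[nx nu] fi].
  apply: exec_weaken (exec_while_end _ _) _ _ => //; last by pointwise.
  by rewrite fi /lay; case: v {fi}.
apply: exec_weaken (exec_while_loop _ (exec_act1 _ _ _) (IH (x :: v) _ nu _)) _ _.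
- by rewrite fi; case: x nx {fi}.
- by lookup; rewrite fi zact_left; case: x nx {fi}.
- lia.
- by rewrite rev_cons cat_rcons; pointwise.
Qed.

Lemma exec_rewind i u v f :
  all nonblank u -> f i = (u, v) ->
  exec (rewind i) f (3 * size u + 3) (upd f i ([::], rev u ++ v)).
Proof.
move=> nu fi; apply: exec_weaken (exec_seq (exec_act1 _ _ _)
  (exec_seq (exec_rewind_loop (v := v) nu _) (exec_act1 _ _ _))) _ _.
- by lookup; rewrite fi.
- lia.
- move=> t; rewrite /upd eqxx; case: eqP => //= _.
  by case: (rev u ++ v).
Qed.

Definition clear (i : nat) : prog := While i nonblank (act1 i pop).

Lemma exec_clear i s f :
  all nonblank s -> f i = ([::], s) ->
  exec (clear i) f (3 * size s + 1) (upd f i empty).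
Proof.
elim: s f => [|x s IH] f /= => [_ fi|/andP[nx ns] fi].
  apply: exec_weaken (exec_while_end _ _) _ _ => //; last by pointwise.
  by rewrite fi.
apply: exec_weaken (exec_while_loop _ (exec_act1 _ _ _) (IH _ ns _)) _ _.
- by rewrite fi.
- by lookup; rewrite fi zact_pop.
- lia.
- by pointwise.
Qed.

Definition transfer (c : symbol -> bool) (i j : nat) : prog :=
  While i c (act2 i j (fun x => (pop, put x))).

Lemma exec_transfer (c : symbol -> bool) i j s r u f :
  i != j -> all nonblank s -> all c s -> ~~ c (head Blank r) ->
  f i = ([::], s ++ r) -> f j = (u, [::]) ->
  exec (transfer c i j) f (3 * size s + 1)
       (upd (upd f i ([::], r)) j (catrev s u, [::])).
Proof.
move=> ij ns cs cr; elim: s u f ns cs => [|x s IH] u f /= => [_ _|/andP[nx ns]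
  /andP[cx cs]] fi fj.
  apply: exec_weaken (exec_while_end _ _) _ _ => //; last by pointwise.
  by rewrite fi.
apply: exec_weaken (exec_while_loop _ (exec_act2 _ _ ij) (IH (x :: u) _ ns cs _ _))
  _ _.
- by rewrite fi.
- by lookup; rewrite fi zact_pop.
- by lookup; rewrite fi fj zact_put.
- lia.
- by pointwise.
Qed.

Definition copy (i j : nat) : prog :=
  While i nonblank (act2 i j (fun x => (shift MoveRight, put x))) ;;
  rewind i ;; rewind j.

Lemma exec_copy_loop i j s u v f :
  i != j -> all nonblank s -> f i = (u, s) -> f j = (v, [::]) ->
  exec (While i nonblank (act2 i j (fun x => (shift MoveRight, put x)))) f
       (3 * size s + 1)
       (upd (upd f i (catrev s u, [::])) j (catrev s v, [::])).
Proof.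
move=> ij; elim: s u v f => [|x s IH] u v f /= => [_|/andP[nx ns]] fi fj.
  apply: exec_weaken (exec_while_end _ _) _ _ => //; last by pointwise.
  by rewrite fi.
apply: exec_weaken (exec_while_loop _ (exec_act2 _ _ ij) (IH (x :: u) (x :: v) _ ns
  _ _)) _ _.
- by rewrite fi.
- by lookup; rewrite fi zact_right.
- by lookup; rewrite fi fj zact_put.
- lia.
- by pointwise.
Qed.

Lemma exec_copy i j s f :
  i != j -> all nonblank s -> f i = ([::], s) -> f j = empty ->
  exec (copy i j) f (9 * size s + 7) (upd f j ([::], s)).
Proof.
move=> ij ns fi fj; have nr : all nonblank (rev s) by rewrite all_rev.
apply: exec_weaken (exec_seq (exec_copy_loop ij ns fi fj)
  (exec_seq (exec_rewind (u := rev s) (v := [::]) nr _)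
            (exec_rewind (u := rev s) (v := [::]) nr _))) _ _.
- by lookup.
- by lookup.
- rewrite size_rev; lia.
- by rewrite revK cats0; pointwise.
Qed.

(* Least significant bit first; leading zeros (a tail of [false]) are allowed. *)
Definition num (s : seq bool) : zipper := ([::], map Bit s).

Lemma nonblank_bits s : all nonblank (map Bit s).
Proof. by elim: s. Qed.
#[local] Hint Resolve nonblank_bits : core.

Fixpoint bval (s : seq bool) : nat :=
  if s is b :: s' then b + (bval s').*2 else 0.

Fixpoint incr (s : seq bool) : seq bool :=
  match s with
  | [::] => [:: true]
  | true :: s' => false :: incr s'
  | false :: s' => true :: s'
  end.

Lemma bval_incr s : bval (incr s) = (bval s).+1.
Proof. by elim: s => [//|[] s IH] /=; rewrite ?IH; lia. Qed.

Lemma size_incr s : size (incr s) <= (size s).+1.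
Proof. by elim: s => [//|[] s /=]; lia. Qed.

(** * Addition *)

Definition carry (c x y : bool) : bool := (x && y) || (c && (x || y)).

Fixpoint addc (c : bool) (s r : seq bool) : seq bool :=
  match r with
  | [::] => if c then incr s else s
  | y :: r' => let x := head false s in
      (x (+) y (+) c) :: addc (carry c x y) (behead s) r'
  end.

Lemma bval_addc c s r : bval (addc c s r) = c + bval s + bval r.
Proof.
elim: r c s => [|y r IH] c s /=; first by case: c; rewrite ?bval_incr; lia.
rewrite IH /carry; case: s => [|x s] /=; first by case: c y => [] []; lia.
by case: c x y => [] [] []; lia.
Qed.

Lemma size_addc c s r : size (addc c s r) <= (maxn (size s) (size r)).+1.
Proof.
elim: r c s => [|y r IH] c s /=; first by have := size_incr s; case: c; lia.
by have := IH (carry c (head false s) y) (behead s); rewrite size_behead; lia.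
Qed.

Definition flag (c : bool) : zipper :=
  ([::], if c then [:: Bit true] else [::]).

Definition add_digit (x y z : symbol) : acts :=
  let: (a, b, c) := (is_true_bit x, is_true_bit y, is_true_bit z) in
  (put (Bit (a (+) b (+) c)), pop,
   (Some (if carry c a b then Bit true else Blank), Stay)).

Definition add_carry (x z _ : symbol) : acts :=
  if is_true_bit x then (put (Bit false), (None, Stay), (None, Stay))
  else (put (Bit true), (Some Blank, Stay), (Some Blank, Stay)).

(* Tape 1 holds the carry; the number on tape [j] is erased. *)
Definition add (i j : nat) : prog :=
  While j nonblank (Act i j 1 add_digit) ;;
  While 1 nonblank (Act i 1 1 add_carry) ;; rewind i.

Lemma zscan_bits u s : zscan (u, map Bit s) = (if s is b :: _ then Bit b else
  Blank).
Proof. by case: s. Qed.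

Lemma exec_add_carry i c u s f :
  i != 1 -> all nonblank u -> f i = (u, map Bit s) -> f 1 = flag c ->
  exists u' v', [/\ rev u' ++ v' = rev u ++ map Bit (if c then incr s else s),
    all nonblank u' & exec (While 1 nonblank (Act i 1 1 add_carry)) f
      (3 * size s + 4) (upd (upd f i (u', v')) 1 empty)].
Proof.
move=> i1; case: c; last first.
  move=> nu fi f1; exists u, (map Bit s); split=> //.
  by apply: exec_weaken (exec_while_end _ _) _ _; [rewrite f1|lia|pointwise].
(* The carry stops either at a digit 0 or at the blank past the number; both are read as not being 1
   and take the same single round. *)
have base u' s' f' : all nonblank u' -> is_true_bit (head Blank (map Bit s')) =
  false ->
    f' i = (u', map Bit s') -> f' 1 = flag true ->
    exec (While 1 nonblank (Act i 1 1 add_carry)) f' 4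
      (upd (upd f' i (Bit true :: u', behead (map Bit s'))) 1 empty).
  move=> nu' hs' fi f1.
  apply: exec_weaken (exec_while_loop _ (exec_act _ _ _ _ _) (exec_while_end _ _))
    _ _ => //.
  - by rewrite f1.
  - by rewrite /act_store /upd eqxx fi f1 /= /zscan /= /add_carry hs'.
  - move=> t; rewrite /act_store fi f1 /= {1 2 3}/zscan /= /add_carry hs' /upd.
    by do ![case: eqP => ?]; subst.
elim: s u f => [|[] s IH] u f nu fi f1.
- exists [:: Bit true & u], [::]; split=> //; first by rewrite rev_cons cat_rcons.
  by apply: exec_weaken (base _ [::] _ nu _ fi f1) _ _.
- have [|||u' [v' [E nu' ex]]] := IH (Bit false :: u) (upd f i (Bit false :: u, map
  Bit s)).
  + by [].
  + by lookup.
  + by lookup.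
  exists u', v'; split=> //; first by rewrite E rev_cons cat_rcons.
  apply: exec_weaken (exec_while_loop _
    (exec_weaken (exec_act _ _ _ _ _) (leqnn _) _) ex) _ _.
  + by rewrite f1.
  + by rewrite fi f1; pointwise.
  + by rewrite /=; lia.
  + by pointwise.
- exists [:: Bit true & u], (map Bit s); split=> //;
  first by rewrite rev_cons cat_rcons.
  by apply: exec_weaken (base _ (false :: s) _ nu erefl fi f1) _ _ => //=; lia.
Qed.

(** Where the loop leaves off depends on the lengths of [s] and [r], so its final state is only
    characterized by an equation: settling the pending carry [c'] on [s'] completes the sum. *)
Lemma exec_add_loop i j c u s r f :
  i != j -> i != 1 -> j != 1 -> all nonblank u ->
  f i = (u, map Bit s) -> f j = num r -> f 1 = flag c ->
  exists u' s' c', [/\ rev u' ++ map Bit (if c' then incr s' else s')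
                      = rev u ++ map Bit (addc c s r),
    all nonblank u', size s' <= size s & exec (While j nonblank (Act i j 1
      add_digit)) f
      (3 * size r + 1)
      (upd (upd (upd f i (u', map Bit s')) j empty) 1 (flag c'))].
Proof.
move=> ij i1 j1; elim: r c u s f => [|y r IH] c u s f nu fi fj f1.
  exists u, s, c; split=> //.
  by apply: exec_weaken (exec_while_end _ _) _ _; [rewrite fj| |pointwise].
have [||||u' [s' [c' [E nu' ss ex]]]] := IH (carry c (head false s) y)
  (Bit (head false s (+) y (+) c) :: u) (behead s)
  (upd (upd (upd f i (Bit (head false s (+) y (+) c) :: u, map Bit (behead s)))
     j (num r)) 1 (flag (carry c (head false s) y))).
- by [].
- by lookup.
- by lookup.
- by lookup.
exists u', s', c'; split=> //.
- by rewrite E /= rev_cons cat_rcons.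
- by move: ss; rewrite size_behead; lia.
apply: exec_weaken (exec_while_loop _
  (exec_weaken (exec_act _ _ _ _ _) (leqnn _) _) ex) _ _.
- by rewrite fj.
- rewrite fi fj f1 /= !zscan_bits /add_digit.
  have -> : is_true_bit (match s with | [::] => Blank | b :: _ => Bit b end)
    = head false s by case: (s).
  have -> : is_true_bit (zscan (flag c)) = c by case: (c).
  by pointwise; rewrite ?fi ?fj ?f1 ?zact_pop ?zact_put ?behead_map //;
     case: (c); case: carry.
- by rewrite /=; lia.
- by pointwise.
Qed.

Lemma exec_add i j s r f :
  i != j -> i != 1 -> j != 1 ->
  f i = num s -> f j = num r -> f 1 = empty ->
  exec (add i j) f (6 * (size s + size r) + 30)
    (upd (upd f i (num (addc false s r))) j empty).
Proof.
move=> ij i1 j1 fi fj f1.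
have [//|u [s' [c [E nu ss ex]]]] := exec_add_loop (c := false) ij i1 j1 _ fi fj f1.
have [||u' [v' [E' nu' ex']]] := exec_add_carry (c := c) (s := s') (f := upd (upd
  (upd f i (u, map Bit s')) j empty) 1 (flag c)) i1 nu.
- by lookup.
- by lookup.
(* The cost of the final rewind is the length to the left of the head, at most that of the whole
   sum. *)
have szu : size u' <= (size s + size r).+1.
  have := congr1 size E'; rewrite E /= !size_cat size_rev size_map.
  by have := size_addc false s r; lia.
apply: exec_weaken (exec_seq ex (exec_seq ex' (exec_rewind nu' _))) _ _.
- by lookup.
- by lia.
- by rewrite E' E; pointwise.
Qed.

(** * Comparison *)

Fixpoint cmpr (z : symbol) (s r : seq bool) : symbol :=
  match r with
  | [::] => foldl (fun z x => if x then Bit false else z) z s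
  | y :: r' => cmpr (if head false s == y then z else Bit y) (behead s) r'
  end.

(** The digits come least significant first, so each difference overrides the previous verdict, and
    the initial [z] survives only between equal numbers. The verdict is the digit of [r] at the
    difference: [Bit false] says that [s] is the larger. *)
Lemma is_false_cmpr z s r :
  is_false_bit (cmpr z s r) =
  (bval r < bval s) || ((bval s == bval r) && is_false_bit z).
Proof.
elim: r z s => [|y r IH] z s /=.
  elim: s z => [|x s IHs] z //=; rewrite IHs.
  by case: x; case: (is_false_bit z) => /=; lia.
rewrite IH; case: s => [|x s] /=.
  by case: y => /=; case: (is_false_bit z) => /=; lia.
by case: x y => [] [] /=; case: (is_false_bit z) => /=; lia.
Qed.

Definition le_digit (x y z : symbol) : acts :=
  let: (a, b) := (is_true_bit x, is_true_bit y) in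
  (pop, pop, (Some (if a == b then z else Bit b), Stay)).

Definition le_rest (x : symbol) (z _ : symbol) : acts :=
  let z' := if is_true_bit x then Bit false else z in
  (pop, (Some z', Stay), (Some z', Stay)).

(* Tape 1 remembers the outcome at the most significant difference seen so far. *)
Definition less_eq (i j : nat) : prog :=
  While j nonblank (Act i j 1 le_digit) ;;
  While i nonblank (Act i 1 1 le_rest) ;;
  If 1 is_false_bit Skip (act1 i (Some (Bit true), Stay)) ;;
  act1 1 (Some Blank, Stay).

Definition cell (z : symbol) : zipper := ([::], lay z [::]).

Lemma zscan_cell z : zscan (cell z) = z.
Proof. by case: z. Qed.

Lemma zact_cell z z' : zact (Some z', Stay) (cell z) = cell z'.
Proof. by case: z. Qed.

Lemma zact_pop_num s : zact pop (num s) = num (behead s).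
Proof. by case: s => [|x []]. Qed.

Lemma exec_le_rest i z s f :
  i != 1 -> f i = num s -> f 1 = cell z ->
  exec (While i nonblank (Act i 1 1 le_rest)) f (3 * size s + 1)
    (upd (upd f i empty) 1 (cell (cmpr z s [::]))).
Proof.
move=> i1; elim: s z f => [|x s IH] z f fi f1.
  by apply: exec_weaken (exec_while_end _ _) _ _; [rewrite fi| |pointwise].
apply: exec_weaken (exec_while_loop _
  (exec_weaken (exec_act _ _ _ _ _) (leqnn _) _) (IH (if x then Bit false else z)
   (upd (upd f i (num s)) 1 (cell (if x then Bit false else z))) _ _)) _ _.
- by rewrite fi.
- rewrite fi f1 zscan_cell /le_rest /=.
  by pointwise; rewrite ?fi ?f1 ?zact_pop_num ?zact_cell.
- by lookup.
- by lookup.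
- by rewrite /=; lia.
- by pointwise.
Qed.

Lemma exec_le_loop i j z s r f :
  i != j -> i != 1 -> j != 1 -> f i = num s -> f j = num r -> f 1 = cell z ->
  exists z' s', [/\ size s' <= size s, cmpr z' s' [::] = cmpr z s r &
    exec (While j nonblank (Act i j 1 le_digit)) f (3 * size r + 1)
      (upd (upd (upd f i (num s')) j empty) 1 (cell z'))].
Proof.
move=> ij i1 j1; elim: r z s f => [|y r IH] z s f fi fj f1.
  exists z, s; split=> //.
  by apply: exec_weaken (exec_while_end _ _) _ _; [rewrite fj| |pointwise].
have [|||z' [s' [ss E ex]]] := IH (if head false s == y then z else Bit y) (behead
  s)
  (upd (upd (upd f i (num (behead s))) j (num r))
     1 (cell (if head false s == y then z else Bit y))).
- by lookup.
- by lookup.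
- by lookup.
exists z', s'; split=> //.
  by move: ss; rewrite size_behead; lia.
apply: exec_weaken (exec_while_loop _
  (exec_weaken (exec_act _ _ _ _ _) (leqnn _) _) ex) _ _.
- by rewrite fj.
- rewrite fi fj f1 /= !zscan_bits zscan_cell /le_digit.
  have -> : is_true_bit (match s with | [::] => Blank | b :: _ => Bit b end)
    = head false s by case: (s).
  by pointwise; rewrite ?fi ?fj ?f1 ?zact_pop_num ?zact_cell.
- by rewrite /=; lia.
- by pointwise.
Qed.

Lemma exec_less_eq i j s r f :
  i != j -> i != 1 -> j != 1 ->
  f i = num s -> f j = num r -> f 1 = empty ->
  exec (less_eq i j) f (3 * (size s + size r) + 10)
    (upd (upd f i (num (if bval s <= bval r then [:: true] else [::]))) j empty).
Proof.
move=> ij i1 j1 fi fj f1.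
have [z [s' [ss E ex]]] := exec_le_loop (z := Blank) ij i1 j1 fi fj f1.
(* Starting from a blank, equal numbers leave a verdict other than [Bit false] and are thus
   accepted. *)
have F := is_false_cmpr Blank s r; rewrite andbF orbF in F.
apply: exec_weaken (exec_seq ex (exec_seq (exec_le_rest (z := z) (s := s') i1 _ _)
  (exec_seq (m := 3) (f2 := upd (upd (upd f i (num (if bval s <= bval r then [::
    true] else [::])))
     j empty) 1 (cell (cmpr z s' [::]))) _ (exec_act1 _ _ _)))) _ _.
- by lookup.
- by lookup.
- apply: exec_if; rewrite {1}/upd eqxx zscan_cell E F ltnNge.
  case: leqP => _ /=.
    by apply: exec_weaken (exec_act1 _ _ _) _ _ => //; pointwise.
  by apply: exec_weaken (exec_skip _) _ _ => //; pointwise.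
- by lia.
- by pointwise; rewrite zact_cell f1.
Qed.

(** * Multiplication by repeated doubling *)

Definition double (i : nat) : prog :=
  act1 i (shift MoveLeft) ;; act1 i (Some (Bit false), Stay).

Lemma exec_double i s f :
  f i = num s -> exec (double i) f 2 (upd f i (num (false :: s))).
Proof.
move=> fi; apply: exec_weaken (exec_seq (exec_act1 _ _ _) (exec_act1 _ _ _)) _ _ =>
  //.
by pointwise; rewrite fi zact_left; case: (s).
Qed.

(* Doubles [i] at each bit of [j], accumulating in [k]; [t] is scratch, since
   addition erases its second argument. *)
Definition mul (i j k t : nat) : prog :=
  While j nonblank (If j is_true_bit (copy i t ;; add k t) Skip ;;
                    act1 j pop ;; double i) ;;
  clear i ;; copy k i ;; clear k.

(** [M] bounds all lengths throughout: in each round [b] loses one digit while [a] gains one, and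
    [c] grows to at most one digit more than the longer of [a] and [c]. *)
Lemma exec_mul_loop i j k t M a b c f :
  uniq [:: 1; i; j; k; t] -> f i = num a -> f j = num b -> f k = num c ->
  f t = empty -> f 1 = empty ->
  size a + size b <= M -> size c + size b <= M ->
  exists a' c', [/\ bval c' = bval c + bval a * bval b, size a' <= M, size c' <= M &
    exec (While j nonblank (If j is_true_bit (copy i t ;; add k t) Skip ;;
                    act1 j pop ;; double i)) f (size b * (21 * M + 50) + 1)
      (upd (upd (upd f i (num a')) j empty) k (num c'))].
Proof.
rewrite /= !inE => U; elim: b a c f => [|x b IH] a c f fi fj fk ft f1 /= aM cM.
  exists a, c; split; rewrite /=; try lia.
  by apply: exec_weaken (exec_while_end _ _) _ _; [rewrite fj|lia|pointwise].
pose c1 := if x then addc false c a else c.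
have szc : size c1 + size b <= M.
  by rewrite /c1; case: x {fj} c1 => //; have := size_addc false c a; lia.
have exb : exec (If j is_true_bit (copy i t ;; add k t) Skip) f (21 * M + 39)
  (upd f k (num c1)).
  case: x @c1 szc fj => c1 szc fj.
    apply: exec_weaken (exec_if (p := copy i t ;; add k t) (q := Skip) (i := j) (c
      := is_true_bit) (f := f) (n := 9 * size a + 7 + (6 * (size c + size a) + 30))
      _) _ _; last by move=> u; exact: erefl.
      rewrite fj /=; apply: exec_weaken (exec_seq (exec_copy (s := map Bit a) _ _
        fi ft) (exec_add (s := c) (r := a) _ _ _ _ _ _)) _ _; try by [lia|lookup].
      by rewrite size_map; lia.
      by pointwise.
    by lia.
  apply: exec_weaken (exec_if (p := copy i t ;; add k t) (q := Skip) (i := j) (c :=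
    is_true_bit) (f := f) (g := f) (n := 0) _) _ _; try lia.
    by rewrite fj; apply: exec_skip.
  by pointwise.
pose f' := upd (upd (upd f k (num c1)) j (num b)) i (num (false :: a)).
have [|||||||a' [c' [E aM' cM' ex]]] := IH (false :: a) c1 f'.
- by rewrite /f'; lookup.
- by rewrite /f'; lookup.
- by rewrite /f'; lookup.
- by rewrite /f'; lookup.
- by rewrite /f'; lookup.
- by rewrite /=; lia.
- by lia.
exists a', c'; split=> //.
  by rewrite E /c1; case: x {fj exb szc f' ex E c1} => /=; rewrite ?bval_addc; nia.
apply: exec_weaken (exec_while_loop _ (exec_weaken (exec_seq exb (exec_seq
  (exec_act1 _ _ _)
  (exec_double (s := a) _))) (leqnn _) _) ex) _ _.
- by rewrite fj.
- by lookup.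
- by rewrite /f'; pointwise; rewrite fj zact_pop_num.
- by nia.
- by rewrite /f'; pointwise.
Qed.

Lemma exec_mul i j k t a b f :
  uniq [:: 1; i; j; k; t] -> f i = num a -> f j = num b -> f k = empty ->
  f t = empty -> f 1 = empty ->
  let M := size a + size b in
  exists c, [/\ bval c = bval a * bval b, size c <= M &
    exec (mul i j k t) f ((M + 1) * (21 * M + 70))
      (upd (upd f i (num c)) j empty)].
Proof.
move=> U fi fj fk ft f1 M.
have [//|//|a' [c [E aM cM ex]]] := exec_mul_loop (M := M) (c := [::]) U fi fj fk
  ft f1.
  by rewrite /M /=; lia.
exists c; split=> //; rewrite /= !inE in U.
apply: exec_weaken (exec_seq ex (exec_seq (exec_clear (nonblank_bits a') _)
  (exec_seq (exec_copy (s := map Bit c) _ (nonblank_bits c) _ _)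
  (exec_clear (nonblank_bits c) _)))) _ _.
- by lookup.
- by lia.
- by lookup.
- by lookup.
- by lookup.
- by rewrite !size_map; nia.
- by pointwise.
Qed.

(** * Canonical binary digits; reading and writing of numbers *)

Lemma bitsE n : bits n = if n == 0 then [::] else odd n :: bits n./2.
Proof.
case: posnP => [->|n0]; first by rewrite /bits up_log1.
rewrite /bits up_log2S // /mkseq -[iota _ _.+1]/(0 :: iota 1 _) map_cons divn1.
congr (_ :: _); rewrite (iotaDl 1) -map_comp; apply: eq_map => i /=.
by rewrite add1n expnS divnMA divn2.
Qed.

Lemma bval_bits n : bval (bits n) = n.
Proof.
elim/ltn_ind: n => n IH; rewrite bitsE; case: posnP => [->|n0] //=.
by rewrite IH ?odd_double_half //; lia.
Qed.

Fixpoint drop_false (s : seq bool) : seq bool :=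
  if s is false :: s' then drop_false s' else s.

Lemma bits_bval s : bits (bval s) = rev (drop_false (rev s)).
Proof.
elim: s => [|b s IH]; first by rewrite bitsE.
have E : bits (bval (b :: s)) =
    if bits (bval s) is [::] then (if b then [:: true] else [::])
    else b :: bits (bval s).
  rewrite bitsE /= oddD odd_double addbF oddb halfD odd_double andbF doubleK.
  rewrite add0n; have -> : b./2 = 0 by case: b.
  rewrite add0n [in RHS]bitsE; have := bitsE (bval s).
  by case: (posnP (bval s)) => [-> ->|n0 ->]; case: b => //=;
    rewrite ?addn0 ?double_eq0 ?eqn0Ngt ?n0.
rewrite E IH rev_cons; elim: (rev s) => [|[] r IHr] //=; first by case: b {E}.
by rewrite -rcons_cons rev_rcons rev_cons; case: (rev r).
Qed.

(** Intermediate results may carry leading zeros, which the output format forbids and which would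
    make a zero look nonblank to a test. *)
Definition strip (i : nat) : prog :=
  While i nonblank (act1 i (shift MoveRight)) ;;
  act1 i (shift MoveLeft) ;;
  While i is_false_bit (act1 i (Some Blank, MoveLeft)) ;; rewind i.

Lemma exec_forward i s u f :
  all nonblank s -> f i = (u, s) ->
  exec (While i nonblank (act1 i (shift MoveRight))) f (3 * size s + 1)
       (upd f i (catrev s u, [::])).
Proof.
elim: s u f => [|x s IH] u f /= => [_ fi|/andP[nx ns] fi].
  apply: exec_weaken (exec_while_end _ _) _ _ => //; last by pointwise.
  by rewrite fi.
apply: exec_weaken (exec_while_loop _ (exec_act1 _ _ _) (IH (x :: u) _ ns _)) _ _.
- by rewrite fi.
- by lookup; rewrite fi zact_right.
- lia.
- by pointwise.
Qed.

Definition on_last (r : seq bool) : zipper :=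
  (behead (map Bit r), lay (head Blank (map Bit r)) [::]).

Lemma exec_drop_false i r f :
  f i = on_last r ->
  exec (While i is_false_bit (act1 i (Some Blank, MoveLeft))) f (3 * size r + 1)
       (upd f i (on_last (drop_false r))).
Proof.
elim: r f => [|[] r IH] f fi /=; rewrite -/drop_false.
- apply: exec_weaken (exec_while_end _ _) _ _; last by pointwise.
  + by rewrite fi.
  + by lia.
- apply: exec_weaken (exec_while_end _ _) _ _; last by pointwise.
  + by rewrite fi.
  + by lia.
apply: exec_weaken (exec_while_loop _ (exec_act1 _ _ _) (IH _ _)) _ _.
- by rewrite fi.
- by lookup; rewrite fi.
- by rewrite /=; lia.
- by pointwise.
Qed.

Lemma exec_strip i s f :
  f i = num s -> exec (strip i) f (9 * size s + 10) (upd f i (num (bits (bval s)))).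
Proof.
move=> fi; have sz : size (drop_false (rev s)) <= size s.
  by rewrite -(size_rev s); elim: (rev s) => [|[] r IH] //=; lia.
apply: exec_weaken (exec_seq (exec_forward (nonblank_bits s) fi)
  (exec_seq (exec_act1 _ _ _) (exec_seq (exec_drop_false (r := rev s) _)
  (exec_rewind (u := behead (map Bit (drop_false (rev s))))
     (v := lay (head Blank (map Bit (drop_false (rev s)))) [::]) _ _)))) _ _.
- lookup; rewrite zact_left /on_last -[catrev _ _]/(rev _).
  by rewrite map_rev.
- by case: (drop_false _) => /=.
- by lookup.
- by rewrite !size_map ?size_behead ?size_map ?size_rev; lia.
- rewrite bits_bval; move=> t; rewrite /upd; case: eqP => // _.
  rewrite /num map_rev; case: (drop_false _) => //= b r.
  by rewrite rev_cons cats1.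
Qed.

Definition emit (i : nat) : prog :=
  transfer nonblank i 0 ;; act1 0 (put Sep).

Lemma exec_emit i n o f :
  i != 0 -> f i = num (bits n) -> f 0 = (o, [::]) ->
  exec (emit i) f (3 * size (bits n) + 2)
    (upd (upd f i empty) 0 (rev (encode_nat n) ++ o, [::])).
Proof.
move=> i0 fi f0; apply: exec_weaken (exec_seq (exec_transfer (s := map Bit (bits
  n)) (r := [::]) i0
  (nonblank_bits _) (nonblank_bits _) _ _ f0) (exec_act1 _ _ _)) _ _ => //.
- by rewrite cats0.
- by rewrite size_map; lia.
- pointwise; rewrite zact_put // /encode_nat rev_rcons /= catrevE.
  by [].
Qed.

Definition read (i j : nat) : prog :=
  transfer is_bit i j ;; act1 i pop ;; rewind j.

Lemma exec_read i j n r f :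
  i != j -> f i = ([::], encode_nat n ++ r) -> f j = empty ->
  exec (read i j) f (6 * size (bits n) + 5)
    (upd (upd f i ([::], r)) j (num (bits n))).
Proof.
move=> ij fi fj.
have nr : all nonblank (rev (map Bit (bits n))) by rewrite all_rev.
apply: exec_weaken (exec_seq (exec_transfer (s := map Bit (bits n)) (r := Sep :: r)
  ij
  (nonblank_bits _) _ _ _ fj) (exec_seq (exec_act1 _ _ _) (exec_rewind nr (v :=
    [::]) _))) _ _ => //.
- by elim: (bits n).
- by rewrite fi /encode_nat cat_rcons.
- by lookup.
- by rewrite size_rev size_map; lia.
- by rewrite revK cats0; pointwise; rewrite zact_pop.
Qed.

(** * Arithmetic expressions over the list of numbers in the input *)

(* Tape 0 is the output, tape 1 a flag, tape 2 a copy of the input, tape 3 stays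
   empty and stands for the variables that are not bound; compiling at level [d]
   uses only the tapes from [d] on, and these are empty before.  A loop on the
   fields of the input consumes a copy of it on tape [c], with the index of the
   current field on tape [c.+1] and its value on tape [c.+2]. *)
Definition for_body (c : nat) (p : prog) : prog :=
  read c c.+2 ;; p ;; clear c.+2 ;;
  act1 c.+3 (Some (Bit true), Stay) ;; add c.+1 c.+3.

Definition for_fields (c : nat) (p : prog) : prog :=
  copy 2 c ;; While c nonblank (for_body c p) ;; clear c.+1.

(* [Sum x e] and [For x s] bind the variable [x] to the index of a field and [x.+1]
   to its value. *)
Inductive expr :=
| Cst of bool
| Var of nat
| Add of expr & expr
| Mul of expr & expr
| Le of expr & expr
| Sum of nat & expr.

Inductive stmt :=
| Nop
| Emit of bool
| EmitNum of expr
| Branch of expr & stmt & stmt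
| For of nat & stmt
| Cat of stmt & stmt.

Definition bind (T : Type) (g : nat -> T) (x : nat) (y z : T) : nat -> T :=
  upd (upd g x y) x.+1 z.

Fixpoint compile (e : expr) (ctx : nat -> nat) (d : nat) : prog :=
  match e with
  | Cst b => if b then act1 d (Some (Bit true), Stay) else Skip
  | Var x => copy (ctx x) d
  | Add e1 e2 => compile e1 ctx d ;; compile e2 ctx d.+1 ;; add d d.+1
  | Mul e1 e2 =>
      compile e1 ctx d ;; compile e2 ctx d.+1 ;; mul d d.+1 d.+2 d.+3
  | Le e1 e2 => compile e1 ctx d ;; compile e2 ctx d.+1 ;; less_eq d d.+1
  | Sum x e =>
      for_fields d.+1 (compile e (bind ctx x d.+2 d.+3) d.+4 ;; add d d.+4)
  end.

Fixpoint compile_stmt (s : stmt) (ctx : nat -> nat) (d : nat) : prog :=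
  match s with
  | Nop => Skip
  | Emit b => act1 0 (put (Bit b))
  | EmitNum e => compile e ctx d ;; strip d ;; emit d
  | Branch e s1 s2 =>
      compile e ctx d ;; strip d ;;
      If d nonblank (clear d ;; compile_stmt s1 ctx d) (compile_stmt s2 ctx d)
  | For x s => for_fields d (compile_stmt s (bind ctx x d.+1 d.+2) d.+3)
  | Cat s1 s2 => compile_stmt s1 ctx d ;; compile_stmt s2 ctx d
  end.

(* Bounds, for inputs and variables of at most [L] symbols, on the number of bits
   of the value of an expression and on the time to evaluate it. *)
Fixpoint width (e : expr) (L : nat) : nat :=
  match e with
  | Cst _ | Le _ _ => 1
  | Var _ => L
  | Add e1 e2 => width e1 L + width e2 L + 1
  | Mul e1 e2 => width e1 L + width e2 L
  | Sum _ e => width e L + L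
  end.

Definition for_cost (L t : nat) : nat := (L + 1) * (t + 30 * L + 80).

Fixpoint cost (e : expr) (L : nat) : nat :=
  match e with
  | Cst _ => 1
  | Var _ => 9 * L + 7
  | Add e1 e2 | Le e1 e2 =>
      cost e1 L + cost e2 L + 6 * (width e1 L + width e2 L) + 30
  | Mul e1 e2 =>
      cost e1 L + cost e2 L + (width e1 L + width e2 L + 1) *
        (21 * (width e1 L + width e2 L) + 70)
  | Sum _ e => for_cost L (cost e L + 12 * width e L + 6 * L + 30)
  end.

Fixpoint stmt_cost (s : stmt) (L : nat) : nat :=
  match s with
  | Nop => 0
  | Emit _ => 1
  | EmitNum e => cost e L + 12 * width e L + 12
  | Branch e s1 s2 =>
      cost e L + 12 * width e L + 13 + stmt_cost s1 L + stmt_cost s2 L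
  | For _ s => for_cost L (stmt_cost s L)
  | Cat s1 s2 => stmt_cost s1 L + stmt_cost s2 L
  end.

(** * Semantics of expressions and statements, and correctness of their compilation *)

Section Fields.

Variable F : seq nat.

Let word : seq symbol := flatten (map encode_nat F).

Fixpoint eval (e : expr) (rho : nat -> nat) : nat :=
  match e with
  | Cst b => b
  | Var x => rho x
  | Add e1 e2 => eval e1 rho + eval e2 rho
  | Mul e1 e2 => eval e1 rho * eval e2 rho
  | Le e1 e2 => eval e1 rho <= eval e2 rho
  | Sum x e => \sum_(k < size F) eval e (bind rho x (k : nat) (nth 0 F k))
  end.

Fixpoint emitted (s : stmt) (rho : nat -> nat) : seq symbol :=
  match s with
  | Nop => [::]
  | Emit b => [:: Bit b]
  | EmitNum e => encode_nat (eval e rho)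
  | Branch e s1 s2 =>
      if 0 < eval e rho then emitted s1 rho else emitted s2 rho
  | For x s =>
      flatten [seq emitted s (bind rho x k (nth 0 F k)) | k <- iota 0 (size F)]
  | Cat s1 s2 => emitted s1 rho ++ emitted s2 rho
  end.

Lemma nonblank_encode_nat n : all nonblank (encode_nat n).
Proof. by rewrite /encode_nat all_rcons /=; elim: (bits n). Qed.

Lemma nonblank_word s : all nonblank (flatten (map encode_nat s)).
Proof. by elim: s => //= n s; rewrite all_cat nonblank_encode_nat. Qed.

Lemma size_encode_nat n : size (encode_nat n) = (size (bits n)).+1.
Proof. by rewrite size_rcons size_map. Qed.

Lemma size_fields : size F <= size word.
Proof.
rewrite /word; elim: F => //= n s IH; rewrite size_cat size_encode_nat; lia.
Qed.

Lemma size_field k : k < size F -> size (bits (nth 0 F k)) <= size word.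
Proof.
rewrite /word; elim: F k => // n s IH [|k] /=; rewrite size_cat size_encode_nat;
  first lia.
by move=> /IH; lia.
Qed.

Definition reg_ok (L : nat) (z : zipper) (v : nat) : Prop :=
  exists s, [/\ z = num s, bval s = v & size s <= L].

Definition env_ok (L : nat) (ctx rho : nat -> nat) (d : nat) (f : store) : Prop :=
  [/\ f 1 = empty, f 2 = ([::], word), forall i, d <= i -> f i = empty &
      forall x, 3 <= ctx x < d /\ reg_ok L (f (ctx x)) (rho x)].

(** Loop rule with invariant [Q] on the accumulator tape [r], the only tape that a round may change
    for good: the partial sum for [Sum], the output for [For]. *)
Lemma exec_for L r c p t (Q : nat -> zipper -> Prop) f :
  size word <= L -> r != 1 -> r != 2 -> r < c -> 2 < c ->
  f 1 = empty -> f 2 = ([::], word) -> (forall i, c <= i -> f i = empty) ->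
  (forall k g, k < size F ->
     (forall i, i \notin [:: r; c; c.+1; c.+2] -> g i = f i) ->
     reg_ok L (g c.+1) k -> reg_ok L (g c.+2) (nth 0 F k) -> Q k (g r) ->
     exists2 z, Q k.+1 z & exec p g t (upd g r z)) ->
  Q 0 (f r) ->
  exists2 z, Q (size F) z & exec (for_fields c p) f (for_cost L t) (upd f r z).
Proof.
move=> wL r1 r2 rc c2 f1 f2 clean body Q0.
have szF := leq_trans size_fields wL.
(* Besides the body, a round reads the field ([6 * L]), clears it ([3 * L]) and increments the index
   ([6 * L]), up to constants. *)
pose T := t + 15 * L + 60.
(* The induction is on the unread fields [s]. Letting the index gain a digit per increment is crude,
   but [size F <= L] makes it enough. *)
have loop s k g j : k + size s = size F -> drop k F = s ->
    (forall i, i \notin [:: r; c; c.+1; c.+2] -> g i = f i) ->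
    g c = ([::], flatten (map encode_nat s)) -> g c.+1 = num j ->
    bval j = k -> size j <= k.+1 -> g c.+2 = empty -> Q k (g r) ->
    exists z j', [/\ Q (size F) z, size j' <= (size F).+1 &
      exec (While c nonblank (for_body c p)) g (size s * T + 1)
        (upd (upd (upd g r z) c empty) c.+1 (num j'))].
  elim: s k g j => [|n s IH] k g j kF dF gf gc gj jk sj gv Qk.
    rewrite addn0 in kF; subst k; exists (g r), j; split=> //; try lia.
      by rewrite -kF.
    by apply: exec_weaken (exec_while_end _ _) _ _; [rewrite gc|lia|pointwise].
  have nE : nth 0 F k = n by rewrite -[k]addn0 -nth_drop dF.
  have kF' : k < size F by rewrite /= in kF; lia.
  have szn := leq_trans (size_field kF') wL; rewrite nE in szn.
  pose g1 := upd (upd g c ([::], flatten (map encode_nat s))) c.+2 (num (bits n)).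
  have [||||z Qz ex] := body k g1 kF'.
  - by move=> i ii; rewrite -gf //; rewrite !inE in ii; rewrite /g1; lookup.
  - by exists j; split=> //; [rewrite /g1; lookup | lia].
  - by exists (bits n); split; rewrite ?bval_bits ?nE //; rewrite /g1; lookup.
  - by rewrite /g1; lookup.
  pose j1 := addc false j [:: true].
  have sj1 : size j1 <= k.+2 by have := size_addc false j [:: true];
    rewrite /= -/j1; lia.
  pose g2 := upd (upd (upd (upd g1 r z) c.+1 (num j1)) c.+2 empty) c.+3 empty.
  have g3 : g c.+3 = empty by rewrite gf ?clean //; [lia | rewrite !inE; lia].
  have g1' : g 1 = empty by rewrite gf // !inE; lia.
  have [|||||||||z' [j' [Qz' sj' ex']]] := IH k.+1 g2 j1.
  - by rewrite -kF /= addnS.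
  - by rewrite -add1n -drop_drop dF /= drop0.
  - move=> i ii; rewrite -gf //; rewrite !inE in ii; rewrite /g2 /g1; lookup => //.
    by subst i.
  - by rewrite /g2 /g1; lookup.
  - by rewrite /g2 /g1; lookup.
  - by rewrite bval_addc jk /=; lia.
  - by [].
  - by rewrite /g2 /g1; lookup.
  - by rewrite /g2 /g1; lookup.
  exists z', j'; split=> //.
  apply: exec_weaken (exec_while_loop _ (exec_weaken (exec_seq
    (exec_read (n := n) (r := flatten (map encode_nat s)) _ _ gv)
    (exec_seq ex (exec_seq (exec_clear (nonblank_bits (bits n)) _)
    (exec_seq (exec_act1 _ _ _) (exec_add (s := j) (r := [:: true]) _ _ _ _ _
      _))))) (leqnn _) _) ex') _ _;
    rewrite ?(size_map Bit); try lia.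
  - by rewrite gc /= /encode_nat; case: (bits n).
  - by rewrite gc.
  - by rewrite /g1; lookup.
  - by rewrite /g1; lookup.
  - by rewrite /g1; lookup; rewrite g3.
  - by rewrite /g1; lookup.
  - by rewrite /g2 /g1; pointwise.
  - by rewrite /= /T; lia.
  - by rewrite /g2 /g1; pointwise.
have fc : f c = empty by rewrite clean.
have [|||||||||z [j [Qz sj ex]]] := loop F 0 (upd f c ([::], word)) [::];
  rewrite ?drop0 //.
- by move=> i; rewrite !inE => ii; lookup.
- by lookup.
- by lookup; rewrite clean //; lia.
- by lookup; rewrite clean //; lia.
- by lookup.
exists z => //.
apply: exec_weaken (exec_seq (exec_copy _ (nonblank_word F) f2 fc)
   (exec_seq ex (exec_clear (nonblank_bits j) _))) _ _.
- lia.
- by lookup.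
- rewrite (size_map Bit) /T /for_cost -/word; nia.
- by have fc1 := clean c.+1 (leqnSn c); pointwise.
Qed.

Lemma env_ok_upd L ctx rho d z f :
  env_ok L ctx rho d f -> env_ok L ctx rho d.+1 (upd f d z).
Proof.
case=> f1 f2 clean ok; have [d4 _] := ok 0.
split=> [||i id|x]; try by lookup.
  by lookup; apply: clean; lia.
have [/andP[x3 xd] rx] := ok x; split; first lia.
by rewrite /upd; case: eqP => // E; lia.
Qed.

Lemma env_ok_bind L ctx rho d r c x k v f g :
  env_ok L ctx rho d f -> d <= c -> r < c -> r = 0 \/ d <= r ->
  (forall i, i \notin [:: r; c; c.+1; c.+2] -> g i = f i) ->
  reg_ok L (g c.+1) k -> reg_ok L (g c.+2) v ->
  env_ok L (bind ctx x c.+1 c.+2) (bind rho x k v) c.+3 g.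
Proof.
case=> f1 f2 clean ok dc rc r0 gf rk rv; have [d4 _] := ok 0.
split=> [||i id|y].
- by rewrite gf // !inE; lia.
- by rewrite gf // !inE; lia.
- by rewrite gf ?clean // ?inE; lia.
rewrite /bind /upd; case: eqP => _; first by split=> //; lia.
case: eqP => _; first by split=> //; lia.
have [/andP[y3 yd] ry] := ok y; split; first lia.
by rewrite gf // !inE; lia.
Qed.

(** Only tape [d] has changed at the end, so all higher tapes are empty again and the second operand
    can be evaluated at level [d.+1]. *)
Lemma exec_compile L e ctx rho d f :
  size word <= L -> env_ok L ctx rho d f ->
  exists s, [/\ bval s = eval e rho, size s <= width e L &
    exec (compile e ctx d) f (cost e L) (upd f d (num s))].
Proof.
move=> wL; elim: e ctx rho d f => [b|x|e1 IH1 e2 IH2|e1 IH1 e2 IH2|e1 IH1 e2 IH2|x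
  e IH]
  ctx rho d f ok; have [f1 f2 clean ctxok] := ok; have [/andP[d3 d4] _] := ctxok 0;
  have {d3 d4} d4 : 3 < d by [lia]; have fd := clean d (leqnn d).
- case: b => /=.
    exists [:: true]; split=> //; apply: exec_weaken (exec_act1 _ _ _) _ _ => //.
    by pointwise.
  exists [::]; split=> //; apply: exec_weaken (exec_skip _) _ _ => //.
  by pointwise.
- have [/andP[x3 xd] [s [E vs ss]]] := ctxok x; exists s; split=> //=.
  apply: exec_weaken (exec_copy _ (nonblank_bits s) E fd) _ _ => //; first lia.
  by rewrite size_map; lia.
- have [s1 [v1 z1 ex1]] := IH1 _ _ _ _ ok.
  have [s2 [v2 z2 ex2]] := IH2 _ _ _ _ (env_ok_upd (num s1) ok).
  exists (addc false s1 s2); split=> /=; first by rewrite bval_addc v1 v2.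
    by have := size_addc false s1 s2; lia.
  apply: exec_weaken (exec_seq ex1 (exec_seq ex2 (exec_add (s := s1) (r := s2) _ _
    _ _ _ _))) _ _;
    try by [lia|lookup].
  by have fd1 := clean d.+1 (leqnSn d); pointwise.
- have [s1 [v1 z1 ex1]] := IH1 _ _ _ _ ok.
  have [s2 [v2 z2 ex2]] := IH2 _ _ _ _ (env_ok_upd (num s1) ok).
  have [||||||c [vc zc ex]] := @exec_mul d d.+1 d.+2 d.+3 s1 s2 (upd (upd f d (num
    s1)) d.+1 (num s2)).
  + by rewrite /= !inE; lia.
  + by lookup.
  + by lookup.
  + by lookup; apply: clean; lia.
  + by lookup; apply: clean; lia.
  + by lookup.
  exists c; split=> /=; first by rewrite vc v1 v2.
    by lia.
  apply: exec_weaken (exec_seq ex1 (exec_seq ex2 ex)) _ _.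
    by nia.
  by have fd1 := clean d.+1 (leqnSn d); pointwise.
- have [s1 [v1 z1 ex1]] := IH1 _ _ _ _ ok.
  have [s2 [v2 z2 ex2]] := IH2 _ _ _ _ (env_ok_upd (num s1) ok).
  exists (if bval s1 <= bval s2 then [:: true] else [::]); split=> /=.
  + by rewrite v1 v2; case: (_ <= _).
  + by case: ifP.
  apply: exec_weaken (exec_seq ex1 (exec_seq ex2 (exec_less_eq (s := s1) (r := s2)
    _ _ _ _ _ _))) _ _;
    try by [lia|lookup].
  by have fd1 := clean d.+1 (leqnSn d); pointwise.
(* Each addition may lengthen the partial sum by one digit, whence the [k]; at most [L] rounds give
   the width of a [Sum]. *)
- pose Q k z := reg_ok (width e L + k) z
    (\sum_(i < k) eval e (bind rho x (i : nat) (nth 0 F i))).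
  have [|||||||k g kF gf rk rv [s [E vs ss]]||z [s [E vs ss]] ex] :=
    @exec_for L d d.+1 (compile e (bind ctx x d.+2 d.+3) d.+4 ;; add d d.+4)
    (cost e L + 12 * width e L + 6 * L + 30) Q f wL; try lia; try done.
  + by move=> i id; apply: clean; lia.
  + have [|s2 [v2 z2 ex2]] := IH _ _ _ _ (@env_ok_bind L ctx rho d d d.+1 x _ _ f g
    ok (leqnSn d) (ltnSn d) _ gf rk rv).
      by right.
    have sF := leq_trans size_fields wL.
    exists (num (addc false s s2)).
      exists (addc false s s2); split=> //.
        by rewrite bval_addc vs v2 big_ord_recr.
      by have := size_addc false s s2; lia.
    apply: exec_weaken (exec_seq ex2 (exec_add (s := s) (r := s2) _ _ _ _ _ _)) _ _;
      try by [lia|lookup].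
    * by lookup; rewrite gf ?f1 // !inE; lia.
    * have gd : g d.+4 = empty by rewrite gf ?clean ?inE //; lia.
      by pointwise.
  + by exists [::]; rewrite big_ord0.
  exists s; split=> //=; first by have := leq_trans size_fields wL; lia.
  by rewrite -E.
Qed.

Lemma env_ok_output L ctx rho d f z :
  env_ok L ctx rho d f -> env_ok L ctx rho d (upd f 0 z).
Proof.
case=> f1 f2 clean ok; have [d4 _] := ok 0.
split=> [||i id|x]; try by lookup.
  by lookup; apply: clean; lia.
have [/andP[x3 xd] rx] := ok x; split; first lia.
by rewrite /upd; case: eqP => // E; lia.
Qed.

Lemma env_ok_eq L ctx rho d f g :
  f =1 g -> env_ok L ctx rho d f -> env_ok L ctx rho d g.
Proof.
move=> fg [f1 f2 clean ok]; split; rewrite -?fg //.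
  by move=> i id; rewrite -fg clean.
by move=> x; rewrite -fg.
Qed.

Lemma size_canonical s : size (bits (bval s)) <= size s.
Proof.
rewrite bits_bval size_rev -[leqRHS]size_rev.
by elim: (rev s) => [|[] r IH] //=; apply: leq_trans IH _.
Qed.

Lemma nonblank_emitted s rho : all nonblank (emitted s rho).
Proof.
elim: s rho => [|b|e|e s1 IH1 s2 IH2|x s IH|s1 IH1 s2 IH2] rho //=.
- exact: nonblank_encode_nat.
- by case: ifP.
- by elim: (iota 0 _) => //= k r; rewrite all_cat IH.
- by rewrite all_cat IH1 IH2.
Qed.

(** The output accumulates, reversed, to the left of the head of tape 0. Its length is bounded
    alongside, to pay for the final rewind of that tape. *)
Lemma exec_compile_stmt L s ctx rho d f o :
  size word <= L -> env_ok L ctx rho d f -> f 0 = (o, [::]) ->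
  size (emitted s rho) <= stmt_cost s L /\
  exec (compile_stmt s ctx d) f (stmt_cost s L)
       (upd f 0 (rev (emitted s rho) ++ o, [::])).
Proof.
move=> wL; elim: s ctx rho d f o => [|b|e|e s1 IH1 s2 IH2|x s IH|s1 IH1 s2 IH2]
  ctx rho d f o ok f0; have [f1 f2 clean ctxok] := ok;
    have [/andP[d3 d4] _] := ctxok 0;
  have {d3 d4} d4 : 3 < d by [lia]; have fd := clean d (leqnn d).
- by split=> //=; apply: exec_weaken (exec_skip _) _ _ => //; pointwise.
- split=> //=; apply: exec_weaken (exec_act1 _ _ _) _ _ => //.
  by pointwise; rewrite f0 zact_put.
- have [s [vs ss ex]] := exec_compile e wL ok.
  have sc := size_canonical s; rewrite vs in sc.
  split=> /=; first by rewrite size_encode_nat; lia.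
  apply: exec_weaken (exec_seq ex (exec_seq (exec_strip (s := s) _)
    (exec_emit (n := eval e rho) (o := o) _ _ _))) _ _; try by [lia|lookup].
  + by lookup; rewrite vs.
  + by pointwise.
- have [s [vs ss ex]] := exec_compile e wL ok.
  have sc := size_canonical s; rewrite vs in sc.
  have [sz1 ex1] := IH1 _ _ _ _ _ ok f0; have [sz2 ex2] := IH2 _ _ _ _ _ ok f0.
  split=> /=; first by case: ifP; lia.
  pose f' := upd f d (num (bits (eval e rho))).
  apply: exec_weaken (exec_seq ex (exec_seq (exec_weaken (exec_strip (s := s) _)
    (leqnn _)
    (_ : _ =1 f')) (exec_if (n := 3 * width e L + 1 + stmt_cost s1 L + stmt_cost s2
      L)
       (g := upd f 0 (rev (if 0 < eval e rho then emitted s1 rho else emitted s2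
         rho) ++ o, [::])) _))) _ _.
  + by lookup.
  + by rewrite /f' -vs; pointwise.
  + have -> : nonblank (zscan (f' d)) = (0 < eval e rho).
      by rewrite /f' /upd eqxx bitsE; case: posnP.
    case: posnP => [e0|e0].
      have [||_ ex0] := IH2 ctx rho d f' o.
      + by apply: env_ok_eq ok; rewrite /f' e0 bitsE; pointwise.
      + by rewrite /f'; lookup.
      apply: exec_weaken ex0 _ _; first lia.
      by rewrite /f' e0 bitsE; pointwise.
    have [||_ ex0] := IH1 ctx rho d (upd f' d empty) o.
    + by apply: env_ok_eq ok; rewrite /f'; pointwise.
    + by rewrite /f'; lookup.
    apply: exec_weaken (exec_seq (exec_clear (nonblank_bits (bits (eval e rho))) _)
      ex0) _ _.
    + by rewrite /f'; lookup.
    + by rewrite (size_map Bit); lia.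
    + by rewrite /f'; pointwise.
  + lia.
  + by move=> t.
- pose E k := flatten [seq emitted s (bind rho x k (nth 0 F k)) | k <- iota 0 k].
  pose Q k (z : zipper) := z = (rev (E k) ++ o, [::]) /\ size (E k) <= k *
    stmt_cost s L.
  have [|||||||k g kF gf rk rv [gE sE]||z [-> sE] ex] :=
    @exec_for L 0 d (compile_stmt s (bind ctx x d.+1 d.+2) d.+3)
    (stmt_cost s L) Q f wL; try lia; try done.
  + have [sz ex] := IH _ _ _ _ (rev (E k) ++ o) (@env_ok_bind L ctx rho d 0 d x _ _
    f g ok (leqnn d) (ltnW (ltnW (ltnW d4))) (or_introl erefl) gf rk rv) gE.
    exists (rev (E k.+1) ++ o, [::]).
      split=> //; rewrite /E -addn1 iotaD map_cat flatten_cat size_cat /= cats0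
        mulnDl.
      by rewrite mul1n add0n leq_add.
    apply: exec_weaken ex _ _ => //.
    rewrite /E -addn1 iotaD map_cat flatten_cat rev_cat /= cats0 add0n catA.
    by pointwise.
  have sF := leq_trans size_fields wL.
  split=> //=; apply: leq_trans sE _; rewrite /for_cost; nia.
- have [sz1 ex1] := IH1 _ _ _ _ _ ok f0.
  have [|sz2 ex2] := IH2 _ _ _ _ (rev (emitted s1 rho) ++ o) (env_ok_output (rev
    (emitted s1 rho) ++ o, [::]) ok).
    by lookup.
  split=> /=; first by rewrite size_cat; lia.
  apply: exec_weaken (exec_seq ex1 ex2) _ _ => //.
  by rewrite rev_cat -catA; pointwise.
Qed.

(** The input is moved to tape 2 to free tape 0 for the output. No variable is bound yet, so all of
    them refer to the empty tape 3, with value 0. *)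
Definition main (s : stmt) : prog :=
  transfer nonblank 0 2 ;; rewind 2 ;; compile_stmt s (fun=> 3) 4 ;; rewind 0.

Definition main_cost (s : stmt) (L : nat) : nat := 6 * L + 10 + 4 * stmt_cost s L.

Lemma computes_emitted s :
  computes_within (machine (code (main s) 0)) (main_cost s (size word)) word
    (emitted s (fun=> 0)).
Proof.
pose f := upd (input_store [::]) 2 ([::], word).
have nw : all nonblank (rev word) by rewrite all_rev nonblank_word.
have ok : env_ok (size word) (fun=> 3) (fun=> 0) 4 f.
  split=> [||i id|x]; try by lookup.
  - by rewrite /f /input_store; lookup.
  - by split=> //; exists [::].
have [//|sz ex] := exec_compile_stmt (o := [::]) s (leqnn _) ok.
apply: (@exec_computes _ _ _ (upd f 0 ([::], emitted s (fun=> 0)))) => //;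
  last first.
  exact: nonblank_emitted.
apply: exec_weaken (exec_seq (exec_transfer (s := word) (r := [::]) (u := [::]) _
  (nonblank_word F)
  (nonblank_word F) _ _ _) (exec_seq (exec_weaken (exec_rewind (v := [::]) nw _)
    (leqnn _) (_ : _ =1 f))
  (exec_seq ex (exec_rewind (u := rev (emitted s (fun=> 0))) (v := [::]) _ _)))) _
    _ => //.
- by rewrite /input_store /= cats0.
- by rewrite /f revK cats0 /input_store /empty; pointwise; case: t.
- by rewrite all_rev nonblank_emitted.
- by lookup; rewrite cats0.
- by rewrite !size_rev /main_cost; lia.
- by rewrite !cats0 revK; pointwise.
Qed.

End Fields.

(** * The cost of a fixed statement is a polynomial in the input length *)

Definition polynomial (f : nat -> nat) : Prop :=
  exists p : {poly nat}, forall n, f n = (p.[n])%R.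

Lemma polynomial_cst c : polynomial (fun=> c).
Proof. by exists (c%:P)%R => n; rewrite hornerC. Qed.

Lemma polynomial_id : polynomial id.
Proof. by exists ('X)%R => n; rewrite hornerX. Qed.

Lemma polynomial_add f g :
  polynomial f -> polynomial g -> polynomial (fun n => f n + g n).
Proof. by case=> [p fE] [q gE]; exists (p + q)%R => n; rewrite hornerD fE gE. Qed.

Lemma polynomial_mul f g :
  polynomial f -> polynomial g -> polynomial (fun n => f n * g n).
Proof. by case=> [p fE] [q gE]; exists (p * q)%R => n; rewrite hornerM fE gE. Qed.

Ltac polynomial_tac :=
  repeat first [assumption | exact: polynomial_cst | exact: polynomial_id
    | apply: polynomial_add | apply: polynomial_mul].

Lemma polynomial_width e : polynomial (width e).
Proof.
elim: e => [b|x|e1 IH1 e2 IH2|e1 IH1 e2 IH2|e1 IH1 e2 IH2|x e IH] /=;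
  by polynomial_tac.
Qed.

Lemma polynomial_cost e : polynomial (cost e).
Proof.
elim: e => [b|x|e1 IH1 e2 IH2|e1 IH1 e2 IH2|e1 IH1 e2 IH2|x e IH] /=;
  rewrite ?/for_cost; try have W1 := polynomial_width e1;
  try have W2 := polynomial_width e2; try have W := polynomial_width e;
    by polynomial_tac.
Qed.

Lemma polynomial_main_cost s : polynomial (main_cost s).
Proof.
suff H : polynomial (stmt_cost s) by rewrite /main_cost; polynomial_tac.
elim: s => [|b|e|e s1 IH1 s2 IH2|x s IH|s1 IH1 s2 IH2] /=; rewrite ?/for_cost;
  try have W := polynomial_width e; try have C := polynomial_cost e;
    by polynomial_tac.
Qed.

(** * The matching problem with degrees one *)

Definition num_nat (q : rat) : nat := `|numq q|%N.
Definition den_nat (q : rat) : nat := `|denq q|%N.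

Lemma ratE (q : rat) : (0 <= q)%R -> q = ((num_nat q)%:R / (den_nat q)%:R)%R.
Proof.
move=> q0; rewrite -[LHS]divq_num_den /num_nat /den_nat !natr_absz.
by rewrite (ger0_norm (_ : 0 <= numq q)%R) ?numq_ge0 // normr_denq.
Qed.

Lemma den_nat_gt0 q : 0 < den_nat q.
Proof. by rewrite absz_gt0 denq_neq0. Qed.

Lemma le_rat_nat (p q : rat) : (0 <= p)%R -> (0 <= q)%R ->
  (p <= q)%R = (num_nat p * den_nat q <= num_nat q * den_nat p).
Proof.
move=> p0 q0; rewrite [in LHS](ratE p0) [in LHS](ratE q0).
rewrite ler_pdivrMr ?ltr0n ?den_nat_gt0 // mulrAC.
by rewrite ler_pdivlMr ?ltr0n ?den_nat_gt0 // -!natrM ler_nat.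
Qed.

(** * The unique candidate for a MEFE matching when all degrees are one *)

Section Characterization.

Variable I : instance.

Definition rivals (t : 'I_(ntas I)) (x : 'I_(ncourses I)) : {set 'I_(ntas I)} :=
  [set s | (0 < ta_util s x) && (grade t x <= grade s x)%R].

Definition selected (t : 'I_(ntas I)) (x : 'I_(ncourses I)) : bool :=
  (0 < ta_util t x) && (#|rivals t x| <= capacity x).

Definition acceptable (x : 'I_(ncourses I)) : bool :=
  (#|[set t | selected t x]| == capacity x) &&
  (num_nat (threshold I) * capacity x <=
   (\sum_(t | selected t x) course_util x t) * den_nat (threshold I)).

Definition greedy : matching I := [ffun t => [pick x | selected t x]].

Hypothesis degree1 : forall t : 'I_(ntas I), degree t = 1.

Lemma course_unique t x y : 0 < ta_util t x -> 0 < ta_util t y -> x = y :>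
  'I_(ncourses I).
Proof.
have /eqP/cards1P[z E] := degree1 t => tx ty.
have : x \in [set z] by rewrite -E inE.
have : y \in [set z] by rewrite -E inE.
by rewrite !inE => /eqP-> /eqP->.
Qed.

Lemma greedyE t x : (greedy t == Some x) = selected t x.
Proof.
rewrite ffunE; case: pickP => [y ty|no]; last by rewrite no.
apply/eqP/idP => [[<-]//|tx]; congr Some.
by case/andP: ty => uy _; case/andP: tx => ux _; apply: course_unique uy ux.
Qed.

Lemma threshold_le (A : {set 'I_(ntas I)}) x :
  (threshold I <= (capacity x)%:R^-1 * \sum_(t in A) (course_util x t)%:R)%R =
  (num_nat (threshold I) * capacity x <=
   (\sum_(t in A) course_util x t) * den_nat (threshold I)).
Proof.
rewrite -natr_sum [in LHS](ratE (threshold_ge0 I)) [(_^-1 * _)%R]mulrC.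
rewrite ler_pdivlMr ?ltr0n ?capacity_gt0 // mulrAC.
by rewrite ler_pdivrMr ?ltr0n ?den_nat_gt0 // -!natrM ler_nat.
Qed.

(** If [ti] envied [tj] at [y], then by transitivity of grades the rivals of [ti] would be among
    those of [tj]; so [ti] would be selected for [y] as well, and have nothing to envy. *)
Lemma greedy_mefe : (forall x, acceptable x) -> mefe greedy.
Proof.
move=> ok; have assignedE x : assigned greedy x = [set t | selected t x].
  by apply/setP => t; rewrite !inE greedyE.
split.
- split=> [x|[t [x [/eqP]]]]; first by rewrite assignedE; case/andP: (ok x) => /eqP.
  by rewrite greedyE => /andP[+ _] E; rewrite E.
- move=> x; rewrite /avg_util threshold_le assignedE.
  have /andP[_] := ok x; congr (_ <= _ * _).
  by apply: eq_bigl => t; rewrite inE.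
- case=> ti [tj [y [/eqP]]]; rewrite greedyE => /andP[uj rj] gij uij.
  have ui : selected ti y.
    apply/andP; split; first exact: leq_ltn_trans uij.
    apply: leq_trans rj; apply: subset_leq_card; apply/subsetP => s.
    by rewrite !inE => /andP[-> /(le_trans gij)].
  have /eqP E : greedy ti == Some y by rewrite greedyE.
  by rewrite E ltnn in uij.
Qed.

Lemma mefeE (mu : matching I) t x : mefe mu -> (mu t == Some x) = selected t x.
Proof.
case=> [[cap pos] _ envy].
have posP s y : mu s = Some y -> 0 < ta_util s y.
  by move=> sy; rewrite lt0n; apply/eqP => u0; apply: pos; exists s, y.
(* Without envy, [s] has positive utility from some course; by degree one that course is [y]. *)
have stable s r y : mu r = Some y -> (grade r y <= grade s y)%R ->
    0 < ta_util s y -> mu s = Some y.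
  move=> ry rs us; have : ~~ (util s (mu s) < ta_util s y).
    by apply/negP => lt; apply: envy; exists s, r, y.
  case E: (mu s) => [z|] /=; last by rewrite us.
  by move=> _; congr Some; apply: course_unique us; apply: posP.
apply/eqP/andP => [tx|[ut rt]].
  have ut := posP _ _ tx; split=> //; rewrite -(cap x); apply: subset_leq_card.
  by apply/subsetP => s; rewrite !inE => /andP[us ts]; apply/eqP;
    apply: stable tx ts us.
(* If [t] is left out of [x], all TAs holding [x] have strictly better grades, hence are rivals of
   [t]; as [t] is its own rival, there are more than [capacity x] rivals. *)
apply/eqP; apply: contraT => /eqP tx; move: rt; rewrite leqNgt -(cap x) => /negP[].
apply: proper_card; apply/properP; split.
  apply/subsetP => s; rewrite !inE => /eqP sx; rewrite (posP _ _ sx) /=.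
  rewrite leNgt; apply/negP => /ltW ts; apply: tx; apply: stable sx ts ut.
by exists t; rewrite !inE ?ut ?lexx //; apply/eqP.
Qed.

Lemma mefe_acceptable (mu : matching I) x : mefe mu -> acceptable x.
Proof.
move=> ok; have E : assigned mu x = [set t | selected t x].
  by apply/setP => t; rewrite !inE mefeE.
have [[cap _] avg _] := ok; apply/andP; split; first by rewrite -E cap.
have := avg x; rewrite /avg_util threshold_le E; congr (_ <= _ * _).
by apply: eq_bigl => t; rewrite inE.
Qed.

End Characterization.

(** * Derived expressions *)

Definition Lt (a b : expr) : expr := Le (Add a (Cst true)) b.
Definition Eq (a b : expr) : expr := Mul (Le a b) (Le b a).
Fixpoint Num (n : nat) : expr :=
  if n is n'.+1 then Add (Cst true) (Num n') else Cst false.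

(* Variable 100 is reserved for the index; [e] must not use it freely. *)
Definition Field (e : expr) : expr :=
  Sum 100 (Mul (Eq (Var 100) e) (Var 101)).

Definition SumBelow (x : nat) (a e : expr) : expr :=
  Sum x (Mul (Lt (Var x) a) e).

Fixpoint free (P : pred nat) (e : expr) : bool :=
  match e with
  | Cst _ => true
  | Var x => P x
  | Add e1 e2 | Mul e1 e2 | Le e1 e2 => free P e1 && free P e2
  | Sum x e => free (fun y => [|| P y, y == x | y == x.+1]) e
  end.

Section Eval.

Variable F : seq nat.

Lemma eval_ext (P : pred nat) e rho rho' :
  free P e -> (forall x, P x -> rho x = rho' x) -> eval F e rho = eval F e rho'.
Proof.
elim: e P rho rho' => [b|x|e1 IH1 e2 IH2|e1 IH1 e2 IH2|e1 IH1 e2 IH2|x e IH] P rho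
  rho' //=;
  first by move=> Px /(_ _ Px).
1-3: by move=> /andP[F1 F2] E; rewrite (IH1 _ _ _ F1 E) (IH2 _ _ _ F2 E).
move=> Pe E; apply: eq_bigr => k _; apply: (IH _ _ _ Pe) => y.
by rewrite /bind /upd; do 2![case: eqP => //= _]; rewrite ?orbF; apply: E.
Qed.

Lemma eval_Var x rho : eval F (Var x) rho = rho x.
Proof. by []. Qed.

Lemma eval_Add a b rho : eval F (Add a b) rho = eval F a rho + eval F b rho.
Proof. by []. Qed.

Lemma eval_Mul a b rho : eval F (Mul a b) rho = eval F a rho * eval F b rho.
Proof. by []. Qed.

Lemma eval_Le a b rho : eval F (Le a b) rho = (eval F a rho <= eval F b rho).
Proof. by []. Qed.

Lemma emitted_Branch e s1 s2 rho : emitted F (Branch e s1 s2) rho =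
  if 0 < eval F e rho then emitted F s1 rho else emitted F s2 rho.
Proof. by []. Qed.

Lemma emitted_Cat s1 s2 rho :
  emitted F (Cat s1 s2) rho = emitted F s1 rho ++ emitted F s2 rho.
Proof. by []. Qed.

Lemma emitted_For x s rho : emitted F (For x s) rho =
  flatten [seq emitted F s (bind rho x k (nth 0 F k)) | k <- iota 0 (size F)].
Proof. by []. Qed.

Lemma eval_Num n rho : eval F (Num n) rho = n.
Proof. by elim: n => //= n ->. Qed.

Lemma eval_Lt a b rho : eval F (Lt a b) rho = (eval F a rho < eval F b rho).
Proof. by rewrite /= addn1. Qed.

Lemma eval_Eq a b rho : eval F (Eq a b) rho = (eval F a rho == eval F b rho).
Proof. by rewrite /= mulnb eqn_leq. Qed.

(** The equality test acts as a Kronecker delta. An index out of range makes every term vanish, in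
    agreement with the default 0 of [nth]. *)
Lemma eval_Field e rho : free (gtn 100) e ->
  eval F (Field e) rho = nth 0 F (eval F e rho).
Proof.
move=> fe; rewrite /Field [LHS]/=; set j := eval F e rho.
have E (k : 'I_(size F)) : eval F (Mul (Eq (Var 100) e) (Var 101))
    (bind rho 100 (k : nat) (nth 0 F k)) = if (k : nat) == j then nth 0 F j else 0.
  rewrite -[LHS]/(eval F (Eq (Var 100) e) _ * _) eval_Eq.
  rewrite (eval_ext (rho' := rho) fe) => [|x x100].
    by rewrite -/j /= /bind /upd /=; case: eqP => [->|_]; rewrite ?mul1n.
  by rewrite /bind /upd; do 2![case: eqP => [xE|_]; first by rewrite xE in x100].
rewrite (eq_bigr _ (fun k _ => E k)) -big_mkcond /=.
case: (ltnP j (size F)) => [jF|Fj]; last first.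
  rewrite nth_default // big1 //.
by rewrite (big_pred1 (Ordinal jF)).
Qed.

(** The loop visits only field indices, hence [m <= size F]; the bound [a] is evaluated under the
    binder, hence must not depend on the bound variables. *)
Lemma eval_SumBelow x a e rho m :
  m <= size F -> (forall k v, eval F a (bind rho x k v) = m) ->
  eval F (SumBelow x a e) rho =
  \sum_(k < m) eval F e (bind rho x (k : nat) (nth 0 F k)).
Proof.
move=> mF aE; rewrite /SumBelow.
rewrite (big_ord_widen _ (fun k => eval F e (bind rho x k (nth 0 F k))) mF).
rewrite [RHS]big_mkcond; apply: eq_bigr => k _.
rewrite -[LHS]/(eval F (Lt (Var x) a) _ * _) eval_Lt aE.
have -> : eval F (Var x) (bind rho x (k : nat) (nth 0 F k)) = k.
  by rewrite /= /bind /upd eqxx; case: eqP => //; lia.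
by case: (k < m); rewrite ?mul1n.
Qed.

End Eval.

(** * Layout of an instance as a list of numbers *)

Definition entries (I : instance) (x : 'I_(ncourses I)) (t : 'I_(ntas I)) : seq nat
  :=
  [:: ta_util t x; num_nat (grade t x); den_nat (grade t x); course_util x t].

Definition course_fields (I : instance) (x : 'I_(ncourses I)) : seq nat :=
  capacity x :: flatten [seq entries x t | t <- enum 'I_(ntas I)].

Definition fields (I : instance) : seq nat :=
  [:: ncourses I; ntas I; num_nat (threshold I); den_nat (threshold I)] ++
  flatten [seq course_fields x | x <- enum 'I_(ncourses I)].

Lemma flatten_map_flatten (T U : Type) (f : T -> seq U) ss :
  flatten (map f (flatten ss)) = flatten [seq flatten (map f s) | s <- ss].
Proof. by elim: ss => //= s ss IH; rewrite map_cat flatten_cat IH. Qed.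

Lemma encode_instanceE I : encode_instance I = flatten (map encode_nat (fields I)).
Proof.
rewrite /encode_instance /fields map_cat flatten_cat /= /encode_rat cats0 -!catA.
do 4!congr (_ ++ _); rewrite flatten_map_flatten -!map_comp.
congr flatten; apply: eq_map => x /=; congr (_ ++ _).
rewrite flatten_map_flatten -!map_comp; congr flatten.
by apply: eq_map => t /=; rewrite cats0 -!catA.
Qed.

Lemma nth_flatten_block (T : Type) (z : T) k ss i j :
  all (fun s => size s == k) ss -> j < k ->
  nth z (flatten ss) (i * k + j) = nth z (nth [::] ss i) j.
Proof.
move=> + jk; elim: ss i => [|s ss IH] [|i] /=; rewrite ?nth_nil //.
  by case/andP=> /eqP sk _; rewrite nth_cat add0n sk jk.
case/andP=> /eqP sk ssk; rewrite nth_cat mulSn sk ltnNge -addnA leq_addr /=.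
by rewrite addKn IH.
Qed.

Lemma size_flatten_block (T : Type) k (ss : seq (seq T)) :
  all (fun s => size s == k) ss -> size (flatten ss) = size ss * k.
Proof.
by elim: ss => //= s ss IH /andP[/eqP sk /IH]; rewrite size_cat sk mulSn => ->.
Qed.

Lemma nth_map_enum (T : Type) (z : T) n (f : 'I_n -> T) (i : 'I_n) :
  nth z (map f (enum 'I_n)) i = f i.
Proof. by rewrite (nth_map i) ?size_enum_ord // nth_ord_enum. Qed.

(** * The algorithm as a statement *)

Definition ntas_expr : expr := Field (Num 1).
Definition ncourses_expr : expr := Field (Num 0).
(** Address of a course block: four header fields, then blocks of one capacity and four entries per
    TA. *)
Definition block_expr (x : expr) : expr :=
  Add (Num 4) (Mul x (Add (Num 1) (Mul ntas_expr (Num 4)))).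
Definition cap_expr (x : expr) : expr := Field (block_expr x).
Definition entry_expr (i : nat) (x t : expr) : expr :=
  Field (Add (block_expr x) (Add (Num 1) (Add (Mul t (Num 4)) (Num i)))).

(* Variable 0 is the course, 2 the TA and 4 a rival. *)
Definition rank_expr : expr :=
  SumBelow 4 ntas_expr
    (Mul (Lt (Cst false) (entry_expr 0 (Var 0) (Var 4)))
         (Le (Mul (entry_expr 1 (Var 0) (Var 2)) (entry_expr 2 (Var 0) (Var 4)))
             (Mul (entry_expr 1 (Var 0) (Var 4)) (entry_expr 2 (Var 0) (Var 2))))).

Definition selected_expr : expr :=
  Mul (Lt (Cst false) (entry_expr 0 (Var 0) (Var 2)))
      (Le rank_expr (cap_expr (Var 0))).

Definition acceptable_expr : expr :=
  Mul (Eq (SumBelow 2 ntas_expr selected_expr) (cap_expr (Var 0)))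
      (Le (Mul (Field (Num 2)) (cap_expr (Var 0)))
          (Mul (SumBelow 2 ntas_expr
                  (Mul selected_expr (entry_expr 3 (Var 0) (Var 2))))
               (Field (Num 3)))).

Definition rejected_expr : expr :=
  SumBelow 0 ncourses_expr (Le acceptable_expr (Cst false)).

(** By degree one at most one term is nonzero, so the sum is the code of the assigned course, or 0
    for an unassigned TA. *)
Definition course_expr : expr :=
  SumBelow 0 ncourses_expr (Mul selected_expr (Add (Var 0) (Cst true))).

Definition mefe_stmt : stmt :=
  Branch rejected_expr (Emit false)
    (Cat (Emit true)
         (For 2 (Branch (Lt (Var 2) ntas_expr) (EmitNum course_expr) Nop))).

(** * The expressions compute the characterization *)

Section Correctness.

Variable I : instance.

Let n := ncourses I.
Let m := ntas I.
Let F := fields I.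

Lemma size_course_fields (x : 'I_n) : size (course_fields x) = 1 + m * 4.
Proof.
have blk : all (fun s => size s == 4) [seq entries x t | t <- enum 'I_m].
  by apply/allP => s /mapP[t _ ->].
by rewrite [LHS]/= (size_flatten_block blk) size_map size_enum_ord.
Qed.

Lemma course_blocks :
  all (fun s => size s == 1 + m * 4) [seq course_fields x | x <- enum 'I_n].
Proof. by apply/allP => s /mapP[x _ ->]; rewrite size_course_fields. Qed.

Lemma nth_fields (x : 'I_n) j : j < 1 + m * 4 ->
  nth 0 F (4 + (x * (1 + m * 4) + j)) = nth 0 (course_fields x) j.
Proof.
move=> jm; rewrite -[LHS]/(nth 0 (flatten _) _).
by rewrite (nth_flatten_block _ _ course_blocks) // nth_map_enum.
Qed.

Lemma nth_capacity (x : 'I_n) : nth 0 F (4 + x * (1 + m * 4)) = capacity x.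
Proof. by rewrite -[x * _]addn0 nth_fields. Qed.

Lemma nth_entry (x : 'I_n) (t : 'I_m) i : i < 4 ->
  nth 0 F (4 + x * (1 + m * 4) + (1 + (t * 4 + i))) = nth 0 (entries x t) i.
Proof.
move=> i4; rewrite -addnA nth_fields; last by have := ltn_ord t; lia.
rewrite -[LHS]/(nth 0 (flatten _) _) nth_flatten_block ?nth_map_enum //.
by apply/allP => s /mapP[t' _ ->].
Qed.

Lemma size_fields_ge : n * (1 + m * 4) <= size F.
Proof.
rewrite /F /fields size_cat (size_flatten_block course_blocks).
by rewrite size_map size_enum_ord leq_addl.
Qed.

Hypothesis degree1 : forall t : 'I_m, degree t = 1.

Lemma ncourses_le : n <= size F.
Proof. by have := size_fields_ge; nia. Qed.

(** Degree one provides a course as soon as there is a TA, and the block of that course alone has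
    more than [m] fields. *)
Lemma ntas_le : m <= size F.
Proof.
case: (posnP m) => [-> //|m0]; have := degree1 (Ordinal m0).
rewrite /degree => /eqP/cards1P[x _].
by have := size_fields_ge; have := ltn_ord x; rewrite -/n; nia.
Qed.

Lemma eval_ntas (rho : nat -> nat) : eval F ntas_expr rho = m.
Proof. by rewrite eval_Field // eval_Num. Qed.

Lemma eval_ncourses (rho : nat -> nat) : eval F ncourses_expr rho = n.
Proof. by rewrite eval_Field // eval_Num. Qed.

Lemma eval_block e rho :
  eval F (block_expr e) rho = 4 + eval F e rho * (1 + m * 4).
Proof.
by rewrite eval_Add eval_Mul eval_Add eval_Mul eval_ntas !eval_Num.
Qed.

Lemma eval_cap (rho : nat -> nat) (x : 'I_n) : rho 0 = x ->
  eval F (cap_expr (Var 0)) rho = capacity x.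
Proof. by move=> rx; rewrite eval_Field // eval_block eval_Var rx nth_capacity. Qed.

Lemma eval_entry i y (rho : nat -> nat) (x : 'I_n) (t : 'I_m) :
  i < 4 -> y < 100 -> rho 0 = x -> rho y = t ->
  eval F (entry_expr i (Var 0) (Var y)) rho = nth 0 (entries x t) i.
Proof.
move=> i4 y100 rx rt; rewrite eval_Field; last first.
  by case: i i4 => [|[|[|[|]]]] //= _; rewrite y100.
rewrite eval_Add eval_block eval_Add [in X in _ + (_ + X)]eval_Add eval_Mul.
by rewrite !eval_Num !eval_Var rx rt nth_entry.
Qed.

Lemma eval_rank (rho : nat -> nat) (x : 'I_n) (t : 'I_m) : rho 0 = x -> rho 2 = t ->
  eval F rank_expr rho = #|rivals t x|.
Proof.
move=> rx rt; rewrite (eval_SumBelow _ ntas_le) => [|k v]; last exact: eval_ntas.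
rewrite -sum1_card [RHS]big_mkcond; apply: eq_bigr => s _; rewrite inE.
set rho' := bind _ _ _ _.
have [r0 r2 r4] : [/\ rho' 0 = x, rho' 2 = t & rho' 4 = s] by [].
rewrite eval_Mul eval_Lt eval_Le !eval_Mul (eval_entry _ _ r0 r4) // !(eval_entry _
  _ r0 r2) // !(eval_entry _ _ r0 r4) //=.
by rewrite -le_rat_nat ?grade_ge0 // mulnb; case: ifP.
Qed.

Lemma eval_selected (rho : nat -> nat) (x : 'I_n) (t : 'I_m) : rho 0 = x -> rho 2 =
  t ->
  eval F selected_expr rho = selected t x.
Proof.
move=> rx rt; by rewrite eval_Mul eval_Lt eval_Le (eval_entry _ _ rx rt) //
  (eval_rank rx rt) (eval_cap rx) mulnb.
Qed.

Lemma eval_acceptable (rho : nat -> nat) (x : 'I_n) : rho 0 = x ->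
  eval F acceptable_expr rho = acceptable x.
Proof.
move=> rx; rewrite eval_Mul eval_Eq eval_Le !eval_Mul (eval_cap rx) !eval_Field //
  !eval_Num mulnb.
rewrite !(eval_SumBelow _ ntas_le); do ?[by move=> *; apply: eval_ntas].
congr (nat_of_bool ((_ == _) && (_ <= _ * _))).
- rewrite -sum1_card [RHS]big_mkcond; apply: eq_bigr => t _.
  by rewrite (@eval_selected _ x t) // inE; case: selected.
- rewrite [RHS]big_mkcond; apply: eq_bigr => t _; set rho' := bind _ _ _ _.
  rewrite eval_Mul (@eval_selected _ x t) // (@eval_entry _ _ _ x t) //.
  by case: selected; rewrite ?mul1n.
Qed.

Lemma eval_rejected (rho : nat -> nat) :
  (eval F rejected_expr rho == 0) = [forall x : 'I_n, acceptable x].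
Proof.
rewrite (eval_SumBelow _ ncourses_le) => [|k v]; last exact: eval_ncourses.
rewrite sum_nat_eq0; apply: eq_forallb => x; rewrite implyTb.
by rewrite [eval F (Le _ _) _]eval_Le (@eval_acceptable _ x) //; case: acceptable.
Qed.

Lemma eval_course (rho : nat -> nat) (t : 'I_m) : rho 2 = t ->
  eval F course_expr rho = if greedy I t is Some x then x.+1 else 0.
Proof.
move=> rt; rewrite (eval_SumBelow _ ncourses_le) => [|k v];
  last exact: eval_ncourses.
have E (x : 'I_n) : eval F (Mul selected_expr (Add (Var 0) (Cst true)))
    (bind rho 0 (x : nat) (nth 0 F x)) = if greedy I t == Some x then x.+1 else 0.
  rewrite eval_Mul eval_Add eval_Var.
  by rewrite (@eval_selected _ x t) // greedyE //; case: selected;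
    rewrite ?mul1n ?addn1.
rewrite (eq_bigr _ (fun x _ => E x)); case: (greedy I t) => [x|];
  last by rewrite big1.
rewrite -big_mkcond (big_pred1 x) // => y; apply/eqP/eqP => [[]|->] //.
Qed.

Lemma emitted_mefe rho :
  emitted F mefe_stmt rho =
  encode_answer (if [forall x : 'I_n, acceptable x] then Some (greedy I) else None).
Proof.
rewrite emitted_Branch lt0n eval_rejected if_neg; case: ifP => // _.
rewrite emitted_Cat emitted_For; congr (_ :: _).
set G := fun k : nat => emitted F _ _.
(* The output loop visits all field indices; those from [m] on fail the test and emit nothing. *)
rewrite -(subnKC ntas_le) iotaD map_cat flatten_cat.
have E k : G k = if k < m then encode_nat (eval F course_expr
    (bind rho 2 k (nth 0 F k))) else [::].
  by rewrite /G emitted_Branch eval_Lt eval_Var eval_ntas lt0b.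
rewrite [X in _ ++ X](_ : _ = [::]) ?cats0; last first.
  have: all (leq m) (iota (0 + m) (size F - m)).
    by apply/allP => k; rewrite mem_iota => /andP[].
  by elim: (iota _ _) => //= k r IH /andP[mk /IH ->]; rewrite E ltnNge mk.
rewrite -val_enum_ord -map_comp; congr flatten; apply: eq_map => t.
by rewrite [LHS]E ltn_ord (@eval_course _ t).
Qed.

End Correctness.

Theorem theorem6 :
  solvable_in_polynomial_time_on encode_instance encode_answer
    (fun I : instance => forall t : 'I_(ntas I), degree t = 1%N)
    mefe.
Proof.
have [p pE] := polynomial_main_cost mefe_stmt.
exists (machine (code (main mefe_stmt) 0)), p => I degree1.
exists (if [forall x : 'I_(ncourses I), acceptable x] then Some (greedy I) else
  None); split.
  rewrite encode_instanceE -pE -(emitted_mefe degree1 (fun=> 0));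
    exact: computes_emitted.
case: ifP => [/forallP|/negbT/forallPn[x nx]]; first exact: greedy_mefe.
by case=> mu /(mefe_acceptable degree1 x); apply/negP.
Qed.
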